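(* Let $X$ be a diffeological space and let $\{A, B\}$ be a $D$-open cover of $X$ (that is, $A, B$ are $D$-open subsets of $X$ with $X = A\cup B$). Let $i_1 : A\cap B \to A$, $i_2 : A\cap B\to B$, $j_1 : A\to X$, $j_2 : B\to X$ be the inclusions. If there exists a partition of unity $\varphi_i : X\to\mathbf{R}$ $(i = A, B)$ subordinate to $\{A,B\}$, then there is a long exact sequence $$\cdots \to H^{p}_{\rm dR}(X) \xrightarrow{j_1^{\ast}\oplus j_2^{\ast}} H^{p}_{\rm dR}(A)\oplus H^{p}_{\rm dR}(B) \xrightarrow{i_1^{\ast}-i_2^{\ast}} H^{p}_{\rm dR}(A\cap B) \xrightarrow{\delta} H^{p+1}_{\rm dR}(X)\to\cdots$$ for some connecting homomorphisms $\delta$, where $(j_1^\ast\oplus j_2^\ast)(\omega) = (j_1^\ast\omega, j_2^\ast\omega)$ and $(i_1^\ast - i_2^\ast)(\alpha,\beta) = i_1^\ast\alpha - i_2^\ast\beta$.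
   Context: A diffeological space is a set $X$ with a family (diffeology) of maps $P:U\to X$ from open subsets $U$ of Euclidean spaces, called plots, such that: constant parametrizations are plots; a parametrization that is a plot in a neighborhood of each point of its domain is a plot; if $P:U\to X$ is a plot and $Q:V\to U$ is a smooth map between open subsets of Euclidean spaces then $P\circ Q$ is a plot. A map $f:X\to Y$ of diffeological spaces is smooth if $f\circ P$ is a plot of $Y$ for each plot $P$ of $X$. $\mathbf{R}$ has its standard diffeology (plots are the smooth maps). A subset $A\subset X$ carries the sub-diffeology: plots of $A$ are the plots of $X$ with image in $A$. A subset $A \subset X$ is $D$-open (resp. $D$-closed) in $X$ if $P^{-1}(A)$ is open (resp. closed) in $U$ for every plot $P:U\to X$; closures $\overline{A}$ are taken in the topology of $D$-open sets ($D$-topology). The support of a smooth $f:X\to\mathbf{R}$ is ${\rm supp} f=\overline{\{x : f(x)\neq 0\}}$. A partition of unity subordinate to a $D$-open cover $\{A_\lambda\}_{\lambda\in\Lambda}$ of $X$ is a collection of smooth functions $\phi_\lambda:X\to\mathbf{R}$ with $0\le\phi_\lambda\le 1$, ${\rm supp}\,\phi_\lambda\subset A_\lambda$, $\{{\rm supp}\,\phi_\lambda\}$ locally finite (each point has a $D$-open neighborhood meeting only finitely many members), and $\sum_\lambda\phi_\lambda(x)=1$ for all $x\in X$. Let $\Lambda^p(\mathbf{R}^n)$ be the space of antisymmetric covariant $p$-tensors on $\mathbf{R}^n$. A differential $p$-form $\alpha$ on $X$ assigns to each plot $P:U\to X$, $U\subset\mathbf{R}^n$ open, an element $\alpha(P)\in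 C^\infty(U,\Lambda^p(\mathbf{R}^n))$ (a smooth $p$-form on $U$) such that $\alpha(P\circ F)=F^\ast(\alpha(P))$ for every smooth $F:V\to U$ with $V$ open in some $\mathbf{R}^m$. $\Omega^p(X)$ is the real vector space of differential $p$-forms; $d:\Omega^p(X)\to\Omega^{p+1}(X)$ is $(d\alpha)(P)=d(\alpha(P))$. $H^p_{\rm dR}(X)={\rm Ker}(d:\Omega^p\to\Omega^{p+1})/{\rm Im}(d:\Omega^{p-1}\to\Omega^p)$. A smooth $f:X\to Y$ induces $f^\ast:\Omega^p(Y)\to\Omega^p(X)$, $f^\ast(\alpha)(P)=\alpha(f\circ P)$, and $f^\ast:H^p_{\rm dR}(Y)\to H^p_{\rm dR}(X)$. *)

(* Defs.v *)
From HB Require Import structures.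
From mathcomp Require Import all_boot all_order all_algebra.
From mathcomp Require Import all_classical all_reals all_analysis.
Set Implicit Arguments.
Unset Strict Implicit.
Unset Printing Implicit Defensive.
Import Order.TTheory GRing.Theory Num.Theory.
Import numFieldNormedType.Exports.
Local Open Scope classical_set_scope.
Local Open Scope ring_scope.

Section SmoothOn.
Context {R : realType}.

(* f is k times continuously (Frechet) differentiable on the open set U.  In
   finite dimension, df : U -> L(V, W) is C^k' as soon as x |-> df_x(v) is C^k'
   for every v. *)
Fixpoint Ck (k : nat) (V W : normedModType R) (U : set V) (f : V -> W) : Prop :=
  if k is k'.+1 then
    (forall x, U x -> differentiable f x) /\
    (forall v, Ck k' U (fun x => 'd f x v))
  else forall x, U x -> {for x, continuous f}.

Definition smooth_on (V W : normedModType R) (U : set V) (f : V -> W) : Prop :=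
  forall k, Ck k U f.

(* For a function defined on an open set U only, the extension by 0 is used to
   take derivatives; the values outside U are irrelevant since U is open. *)
Lemma valL_val (T : Type) (U : set T) (W : Type) (w : W) (h : U -> W) (y : U) :
  'valL_w h (set_val y) = h y.
Proof. by rewrite -[LHS]/(sigL U _ y) valLK. Qed.

Lemma valL_Sub (T : Type) (U : set T) (W : Type) (w : W) (h : U -> W) (x : T)
  (Ux : U x) : 'valL_w h x = h (SigSub (mem_set Ux)).
Proof. exact: (valL_val w h (SigSub (mem_set Ux))). Qed.

Definition set_incl (T : Type) (A B : set T) (AB : A `<=` B) (x : A) : B :=
  SigSub (mem_set (AB _ (set_valP x))).

Definition smooth (V W : normedModType R) (U : set V) (f : U -> W) : Prop :=
  smooth_on U ('valL_0 f).

Lemma near_eq_diff (V W : normedModType R) (f g : V -> W) (x : V) :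
  (\near x, f x = g x) -> differentiable f x ->
  differentiable g x /\ 'd g x = 'd f x :> (V -> W).
Proof.
move=> fg df.
have fg' : \forall y \near (0 : V), f (y + x) = g (y + x).
  have : (fun y : V => y + x) @ (0 : V) --> x.
    rewrite -[X in _ --> X]add0r.
    by apply: cvgD; [exact: cvg_id | exact: cvg_cst].
  by move=> /(_ _ fg).
have e : g \o shift x = cst (g x) + 'd f x +o_ 0 id.
  apply/eqaddoP => eps eps0.
  have := diff_locally df => /eqaddoP /(_ _ eps0) h.
  near=> y.
  have -> : (g \o shift x - (cst (g x) + 'd f x)) y
          = (f \o shift x - (cst (f x) + 'd f x)) y.
    rewrite !fctE /= (nbhs_singleton fg).
    by congr (_ - _); apply/esym; near: y.
  by near: y.
have [cf _] := (diff_locallyP _ _).1 df.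
have E := diff_unique cf e.
split; last exact: E.
by apply/(diff_locallyP x g); rewrite E; split; [exact: cf | exact: e].
Unshelve. all: by end_near. Qed.

Lemma Ck_ext k (V W : normedModType R) (U : set V) (f g : V -> W) :
  open U -> (forall x, U x -> f x = g x) -> Ck k U f -> Ck k U g.
Proof.
move=> oU; elim: k f g => [|k IH] f g fg /=.
  move=> cf x Ux; rewrite /prop_for /continuous_at -(fg _ Ux).
  apply: cvg_trans (cf x Ux); apply: near_eq_cvg.
  by apply: filterS (open_nbhs_nbhs (conj oU Ux)) => y Uy; rewrite fg.
have fgn x : U x -> \near x, f x = g x.
  by move=> Ux; apply: filterS (open_nbhs_nbhs (conj oU Ux)).
case=> df Cf; split=> [x Ux|v].
  by case: (near_eq_diff (fgn x Ux) (df x Ux)).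
apply: IH (Cf v) => x Ux.
by case: (near_eq_diff (fgn x Ux) (df x Ux)) => _ ->.
Qed.

Lemma CkW k (V W : normedModType R) (U : set V) (f : V -> W) :
  Ck k.+1 U f -> Ck k U f.
Proof.
elim: k f => [|k IH] f /=.
  by move=> [df _] x Ux; apply: differentiable_continuous; exact: df.
by move=> [df Cf]; split=> // v; apply: IH.
Qed.

Lemma Ck_cst k (V W : normedModType R) (U : set V) (c : W) : Ck k U (fun=> c).
Proof.
elim: k c => [|k IH] c /=; first by move=> x _; exact: cvg_cst.
split=> [x _|v]; first exact: differentiable_cst.
rewrite (_ : (fun x : V => 'd (fun=> c) x v) = fun=> 0) //.
by apply/funext => x; rewrite (diff_cst c x).
Qed.

Lemma Ck_add k (V W : normedModType R) (U : set V) (f g : V -> W) :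
  open U -> Ck k U f -> Ck k U g -> Ck k U (f + g).
Proof.
move=> oU; elim: k f g => [|k IH] f g /=.
  by move=> cf cg x Ux; apply: cvgD; [exact: cf | exact: cg].
move=> [df Cf] [dg Cg]; split=> [x Ux|v].
  by apply: differentiableD; [exact: df | exact: dg].
apply: Ck_ext (IH _ _ (Cf v) (Cg v)) => // x Ux.
by rewrite diffD //; [exact: df | exact: dg].
Qed.

Lemma Ck_mul k (V : normedModType R) (U : set V) (f g : V -> R^o) :
  open U -> Ck k U f -> Ck k U g -> Ck k U (f * g).
Proof.
move=> oU; elim: k f g => [|k IH] f g Cf Cg.
  by move=> x Ux; apply: cvgM; [exact: Cf | exact: Cg].
have Cf' := CkW Cf; have Cg' := CkW Cg.
case: Cf Cg => df Cf [dg Cg]; split=> [x Ux|v].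
  by apply: differentiableM; [exact: df | exact: dg].
apply: Ck_ext (Ck_add oU (IH _ _ Cf' (Cg v)) (IH _ _ Cg' (Cf v))) => // x Ux.
by rewrite diffM //; [exact: df | exact: dg].
Qed.

Lemma Ck_sum k (V W : normedModType R) (U : set V) n (f : 'I_n -> V -> W) :
  open U -> (forall i, Ck k U (f i)) -> Ck k U (\sum_i f i).
Proof.
move=> oU Cf; elim/big_rec: _ => [|i g _]; first exact: Ck_cst.
exact: Ck_add.
Qed.

Lemma Ck_lin k (V W W' : normedModType R) (U : set V) (l : {linear W -> W'})
    (f : V -> W) : open U -> continuous l -> Ck k U f -> Ck k U (l \o f).
Proof.
move=> oU cl; elim: k f => [|k IH] f /=.
  by move=> cf x Ux; apply: continuous_comp; [exact: cf | exact: cl].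
move=> [df Cf]; split=> [x Ux|v].
  apply: differentiable_comp; first exact: df.
  exact: linear_differentiable.
apply: Ck_ext (IH _ (Cf v)) => // x Ux.
rewrite diff_comp; [|exact: df|exact: linear_differentiable].
by rewrite (diff_lin _ cl).
Qed.

Definition rV_coord n (j : 'I_n) (x : 'rV[R]_n) : R^o := x ord0 j.

Lemma rV_coord_linear n (j : 'I_n) : linear (rV_coord j).
Proof. by move=> a x y; rewrite /rV_coord !mxE. Qed.

HB.instance Definition _ n (j : 'I_n) :=
  GRing.isLinear.Build R 'rV[R]_n R^o *:%R (rV_coord j) (rV_coord_linear j).

Lemma Ck_coord k (V : normedModType R) (U : set V) n (f : V -> 'rV[R]_n) j :
  open U -> Ck k U f -> Ck k U (fun x => f x ord0 j : R^o).
Proof.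
move=> oU; move=> Cf; apply: (@Ck_lin _ _ _ _ _ (rV_coord j)) => //.
exact: coord_continuous.
Qed.

Lemma lin_rVE n (l : {linear 'rV[R]_n -> R^o}) (w : 'rV[R]_n) :
  l w = \sum_j w ord0 j * l (delta_mx ord0 j).
Proof.
have -> : l w = l (\sum_j w ord0 j *: delta_mx ord0 j) by rewrite -row_sum_delta.
by rewrite linear_sum; apply: eq_bigr => j _; rewrite linearZ.
Qed.

Lemma Ck_comp k (V : normedModType R) n (U : set 'rV[R]_n) (W : set V)
    (f : 'rV[R]_n -> R^o) (g : V -> 'rV[R]_n) :
  open U -> open W -> (forall x, W x -> U (g x)) ->
  Ck k U f -> Ck k W g -> Ck k W (f \o g).
Proof.
move=> oU oW gU; elim: k f => [|k IH] f Cf Cg.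
  move=> x Wx; apply: continuous_comp; first exact: Cg.
  exact/Cf/gU.
have Cg' := CkW Cg; case: Cf Cg => df Cf [dg Cg]; split=> [x Wx|v].
  by apply: differentiable_comp; [exact: dg | exact/df/gU].
have C : Ck k W (\sum_j (fun x => 'd g x v ord0 j : R^o) *
                         ((fun y => 'd f y (delta_mx ord0 j)) \o g)).
  apply: (Ck_sum oW) => j; apply: (Ck_mul oW).
    exact: (Ck_coord j oW (Cg v)).
  exact: (IH _ (Cf _) Cg').
apply: Ck_ext C => // x Wx.
rewrite diff_comp; [|exact: dg|exact/df/gU].
by rewrite fct_sumE; apply/esym/(lin_rVE ('d f (g x))).
Qed.

Lemma smooth_comp m n (U : set 'rV[R]_n) (V : set 'rV[R]_m)
    (f : U -> R^o) (g : V -> U) :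
  open U -> open V -> smooth f -> smooth (set_val \o g) -> smooth (f \o g).
Proof.
move=> oU oV sf sg k.
have := @Ck_comp k _ _ U V _ _ oU oV _ (sf k) (sg k).
have valV (y : 'rV[R]_m) (Vy : V y) : exists x : V, y = set_val x.
  by exists (SigSub (mem_set Vy)).
have gU x : V x -> U ('valL_0 (set_val \o g) x).
  move=> /valV [y ->]; rewrite -[X in U X]/(sigL V _ y) valLK /=.
  exact: set_valP.
move=> /(_ gU); apply: Ck_ext => // _ /valV [y ->].
have E W (h : V -> W) (w : W) : 'valL_w h (set_val y) = h y.
  by rewrite -[LHS]/(sigL V _ y) valLK.
have E' (u : U) : 'valL_0 f (set_val u) = f u.
  by rewrite -[LHS]/(sigL U _ u) valLK.
rewrite E -[LHS]/('valL_0 f ('valL_0 (set_val \o g) (set_val y))) E.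
exact: E'.
Qed.

Lemma Ck_local k (V W : normedModType R) (U : set V) (f : V -> W) :
  (forall x, U x -> exists N : set V, N x /\ Ck k N f) -> Ck k U f.
Proof.
elim: k f => [|k IH] f H; first by move=> x /H[N [Nx]]; exact.
split=> [x /H[N [Nx [+ _]]]|v]; first exact.
by apply: IH => x /H[N [Nx [_ Cf]]]; exists N; split; [|exact: Cf].
Qed.

Lemma smooth_local n (U : set 'rV[R]_n) (W : normedModType R) (f : U -> W) :
  open U ->
  (forall u : U, exists (N : set 'rV[R]_n) (NU : N `<=` U),
     [/\ open N, N (set_val u) & smooth (f \o set_incl NU)]) ->
  smooth f.
Proof.
move=> oU H k; apply: Ck_local => x Ux.
have [N [NU [oN Nx sf]]] := H (SigSub (mem_set Ux)).
exists N; split=> //; apply: Ck_ext (sf k) => // y Ny.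
have E1 : 'valL_0 (f \o set_incl NU) y = (f \o set_incl NU) (SigSub (mem_set Ny)).
  exact: valL_Sub.
have E2 : 'valL_0 f y = f (SigSub (mem_set (NU _ Ny))).
  exact: valL_Sub.
by rewrite E1 E2; congr f; apply: val_inj.
Qed.

Lemma smooth_cst n (U : set 'rV[R]_n) (W : normedModType R) (c : W) :
  open U -> smooth (fun _ : U => c).
Proof.
move=> oU k; apply: (Ck_ext oU _ (Ck_cst k U c)) => x Ux.
by apply/esym/(valL_Sub _ (fun=> c) Ux).
Qed.

Lemma valL0_linear n (U : set 'rV[R]_n) (W : normedModType R) a (f g : U -> W) :
  'valL_0 (a *: f + g) = a *: 'valL_0 f + 'valL_0 g.
Proof.
apply/funext => x.
have [Ux|Ux] := pselect (U x).
  have E (h : U -> W) : 'valL_0 h x = h (SigSub (mem_set Ux)).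
    exact: valL_Sub.
  by rewrite -[RHS]/(a *: 'valL_0 f x + 'valL_0 g x) !E.
have E (h : U -> W) : 'valL_0 h x = 0.
  by rewrite /valL_ /= oinv_set_val insubN //; apply/negP => /set_mem.
by rewrite -[RHS]/(a *: 'valL_0 f x + 'valL_0 g x) !E scaler0 addr0.
Qed.

Lemma Ck_scale k (V W : normedModType R) (U : set V) a (f : V -> W) :
  open U -> Ck k U f -> Ck k U (a *: f).
Proof.
move=> oU; elim: k f => [|k IH] f /=.
  by move=> cf x Ux; apply: cvgZr; exact: cf.
move=> [df Cf]; split=> [x Ux|v].
  by apply: differentiableZ; exact: df.
apply: Ck_ext (IH _ (Cf v)) => // x Ux.
by rewrite diffZ //; exact: df.
Qed.

Lemma smooth_linear n (U : set 'rV[R]_n) (W : normedModType R) a (f g : U -> W) :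
  open U -> smooth f -> smooth g -> smooth (a *: f + g).
Proof.
by move=> oU sf sg k; rewrite valL0_linear; apply: Ck_add => //; apply: Ck_scale.
Qed.

Lemma smooth_differentiable n (U : set 'rV[R]_n) (W : normedModType R)
  (f : U -> W) (x : U) : smooth f -> differentiable ('valL_0 f) (set_val x).
Proof. by move=> sf; have [+ _] := sf 1; apply; exact: set_valP. Qed.
End SmoothOn.

HB.mixin Record isDiffeological (R : realType) (X : Type) := {
  is_plot : forall n (U : set 'rV[R]_n), (U -> X) -> Prop;
  is_plot_open : forall n (U : set 'rV[R]_n) (P : U -> X),
    is_plot n U P -> open U;
  is_plot_cst : forall n (U : set 'rV[R]_n) (x : X),
    open U -> is_plot n U (fun=> x);
  is_plot_local : forall n (U : set 'rV[R]_n) (P : U -> X), open U ->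
    (forall u : U, exists (N : set 'rV[R]_n) (NU : N `<=` U),
       N (set_val u) /\ is_plot n N (P \o set_incl NU)) ->
    is_plot n U P;
  is_plot_comp : forall n (U : set 'rV[R]_n) (P : U -> X)
      m (V : set 'rV[R]_m) (Q : V -> U),
    is_plot n U P -> open V -> smooth (set_val \o Q) -> is_plot m V (P \o Q)
}.

#[short(type="diffeologicalType")]
HB.structure Definition Diffeological (R : realType) :=
  { X of isDiffeological R X }.

Arguments is_plot {R s n} U P : rename.
Arguments is_plot_open {R s n U P} : rename.
Arguments is_plot_comp {R s n U P m V Q} : rename.

Section Standard.
Context {R : realType}.

Definition std_plot n (U : set 'rV[R]_n) (P : U -> R^o) := open U /\ smooth P.

Lemma std_plot_open n (U : set 'rV[R]_n) (P : U -> R^o) : std_plot P -> open U.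
Proof. by case. Qed.

Lemma std_plot_cst n (U : set 'rV[R]_n) (x : R^o) :
  open U -> std_plot (fun _ : U => x).
Proof. by move=> oU; split; [|exact: smooth_cst]. Qed.

Lemma std_plot_local n (U : set 'rV[R]_n) (P : U -> R^o) : open U ->
  (forall u : U, exists (N : set 'rV[R]_n) (NU : N `<=` U),
     N (set_val u) /\ std_plot (P \o set_incl NU)) ->
  std_plot P.
Proof.
move=> oU H; split=> //; apply: smooth_local => // u.
by have [N [NU [Nu [oN sP]]]] := H u; exists N, NU.
Qed.

Lemma std_plot_comp n (U : set 'rV[R]_n) (P : U -> R^o) m (V : set 'rV[R]_m)
    (Q : V -> U) :
  std_plot P -> open V -> smooth (set_val \o Q) -> std_plot (P \o Q).
Proof. by move=> [oU sP] oV sQ; split=> //; exact: smooth_comp. Qed.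

HB.instance Definition _ := isDiffeological.Build R R^o
  std_plot_open std_plot_cst std_plot_local std_plot_comp.
End Standard.

Section SubDiffeology.
Context {R : realType} {X : diffeologicalType R} (A : set X).

Definition sub_plot n (U : set 'rV[R]_n) (P : U -> A) := is_plot U (set_val \o P).

Lemma sub_plot_open n (U : set 'rV[R]_n) (P : U -> A) : sub_plot P -> open U.
Proof. exact: is_plot_open. Qed.

Lemma sub_plot_cst n (U : set 'rV[R]_n) (x : A) :
  open U -> sub_plot (fun _ : U => x).
Proof. exact: is_plot_cst. Qed.

Lemma sub_plot_local n (U : set 'rV[R]_n) (P : U -> A) : open U ->
  (forall u : U, exists (N : set 'rV[R]_n) (NU : N `<=` U),
     N (set_val u) /\ sub_plot (P \o set_incl NU)) ->
  sub_plot P.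
Proof. exact: is_plot_local. Qed.

Lemma sub_plot_comp n (U : set 'rV[R]_n) (P : U -> A) m (V : set 'rV[R]_m)
    (Q : V -> U) :
  sub_plot P -> open V -> smooth (set_val \o Q) -> sub_plot (P \o Q).
Proof. exact: is_plot_comp. Qed.

HB.instance Definition _ := isDiffeological.Build R (set_type A)
  sub_plot_open sub_plot_cst sub_plot_local sub_plot_comp.
End SubDiffeology.

Section SmoothMaps.
Context {R : realType}.

Definition is_smooth (X Y : diffeologicalType R) (f : X -> Y) : Prop :=
  forall n (U : set 'rV[R]_n) (P : U -> X), is_plot U P -> is_plot U (f \o P).

Record smooth_map (X Y : diffeologicalType R) := SmoothMap {
  smooth_fun :> X -> Y;
  smooth_funP : is_smooth smooth_fun
}.

Lemma is_smooth_val (X : diffeologicalType R) (A : set X) :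
  is_smooth (set_val : A -> X).
Proof. by []. Qed.

Lemma is_smooth_incl (X : diffeologicalType R) (A B : set X) (AB : A `<=` B) :
  is_smooth (set_incl AB).
Proof. by []. Qed.

Definition incl_space (X : diffeologicalType R) (A : set X) : smooth_map A X :=
  SmoothMap (@is_smooth_val X A).

Definition incl_sub (X : diffeologicalType R) (A B : set X) (AB : A `<=` B) :
  smooth_map A B := SmoothMap (is_smooth_incl AB).
End SmoothMaps.

Section DTopology.
Context {R : realType} {X : diffeologicalType R}.

(* P @^-1` A is a subset of the open set U, so it is open in U if and only if
   its image in R^n is open. *)
Definition Dopen (A : set X) : Prop :=
  forall n (U : set 'rV[R]_n) (P : U -> X),
    is_plot U P -> open (set_val @` (P @^-1` A)).

Lemma DopenT : Dopen setT.
Proof.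
move=> n U P pP; rewrite preimage_setT.
rewrite (_ : _ @` _ = U); first exact: is_plot_open pP.
apply/seteqP; split=> [_ [x _ <-]|x Ux]; first exact: set_valP.
by exists (SigSub (mem_set Ux)).
Qed.

Lemma DopenI : setI_closed Dopen.
Proof.
move=> A B oA oB n U P pP.
rewrite (_ : _ @` _ = set_val @` (P @^-1` A) `&` set_val @` (P @^-1` B)).
  by apply: openI; [exact: oA | exact: oB].
apply/seteqP; split=> [_ [x [Ax Bx] <-]|_ [[x Ax <-] [y By /val_inj yx]]].
  by split; exists x.
by exists x => //; split => //; rewrite -yx.
Qed.

Lemma Dopen_bigcup (I : Type) (F : I -> set X) :
  (forall i, Dopen (F i)) -> Dopen (\bigcup_i F i).
Proof.
move=> oF n U P pP.
rewrite (_ : _ @` _ = \bigcup_i (set_val @` (P @^-1` F i))).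
  by apply: bigcup_open => i _; exact: oF.
apply/seteqP; split=> [_ [x [i _ Fx] <-]|_ [i _ [x Fx <-]]].
  by exists i => //; exists x.
by exists x => //; exists i.
Qed.

End DTopology.

(* A copy of X equipped with the D-topology. *)
Definition Dspace (R : realType) (X : diffeologicalType R) : Type := X.

HB.instance Definition _ (R : realType) (X : diffeologicalType R) :=
  gen_eqMixin (Dspace X).
HB.instance Definition _ (R : realType) (X : diffeologicalType R) :=
  gen_choiceMixin (Dspace X).
HB.instance Definition _ (R : realType) (X : diffeologicalType R) :=
  isOpenTopological.Build (Dspace X) (@DopenT R X) (@DopenI R X)
    (@Dopen_bigcup R X).

Section PartitionOfUnity.
Context {R : realType} {X : diffeologicalType R}.

Definition supp (f : X -> R^o) : set X :=
  closure ([set x | f x != 0] : set (Dspace X)).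

(* The sum over L is the sum of the nonzero terms when there are finitely many
   of them, which local finiteness guarantees. *)
Definition partition_of_unity (L : choiceType) (A : L -> set X)
    (phi : L -> X -> R^o) : Prop :=
  [/\ forall l, is_smooth (phi l),
      forall l x, 0 <= phi l x <= 1,
      forall l, supp (phi l) `<=` A l,
      forall x, exists N : set X, [/\ Dopen N, N x &
        finite_set [set l | N `&` supp (phi l) !=set0]] &
      forall x, \sum_(l \in [set: L]) phi l x = 1].
End PartitionOfUnity.

Section Plots.
Context {R : realType}.

Record plot (X : diffeologicalType R) := Plot {
  pdim : nat;
  pdom : set 'rV[R]_pdim;
  pfun :> pdom -> X;
  plotP : is_plot pdom pfun
}.
Arguments pdom {X} p.

Definition plot_comp (X : diffeologicalType R) (P : plot X) m (V : set 'rV[R]_m)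
    (F : V -> pdom P) (oV : open V) (sF : smooth (set_val \o F)) : plot X :=
  Plot (is_plot_comp (plotP P) oV sF).

Definition plot_push (X Y : diffeologicalType R) (f : smooth_map X Y)
  (P : plot X) : plot Y := Plot (smooth_funP f (plotP P)).
End Plots.
Arguments pdom {R X} p.

Section Tensors.
Context {R : realType} {p n : nat}.

(* A covariant p-tensor on R^n is represented as a function of the p x n matrix
   whose rows are the p vector arguments. *)
Definition multilinear_rows (w : 'M[R]_(p, n) -> R) : Prop :=
  forall (i : 'I_p) (a : R) (M A B : 'M[R]_(p, n)),
    row i M = a *: row i A + row i B ->
    row' i A = row' i M -> row' i B = row' i M -> w M = a * w A + w B.

Definition antisymmetric_rows (w : 'M[R]_(p, n) -> R) : Prop :=
  forall (i j : 'I_p) (M : 'M[R]_(p, n)), i != j -> w (xrow i j M) = - w M.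

(* (d w)_x (v_0, ..., v_p)
     = \sum_i (-1)^i D_{v_i} (w (v_0, ..., v_{i-1}, v_{i+1}, ..., v_p)) (x) *)
Definition ext_deriv (U : set 'rV[R]_n) (w : U -> 'M[R]_(p, n) -> R)
    (x : U) (M : 'M[R]_(p.+1, n)) : R :=
  \sum_(i < p.+1) (-1) ^+ i *
    'd ('valL_0 (fun y : U => w y (row' i M) : R^o)) (set_val x) (row i M).
End Tensors.

(* Families of (not necessarily smooth, antisymmetric or natural) tensor fields
   indexed by the plots of X. *)
Definition preform (R : realType) (p : nat) (X : diffeologicalType R) : Type :=
  forall P : plot X, pdom P -> 'M[R]_(p, pdim P) -> R.

Section PreformLmodule.
Context {R : realType} {p : nat} {X : diffeologicalType R}.
Local Notation T := (preform p X).

HB.instance Definition _ := gen_eqMixin T.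
HB.instance Definition _ := gen_choiceMixin T.

Let pf_ext (a b : T) : (forall P x M, a P x M = b P x M) -> a = b.
Proof.
move=> ab; apply: functional_extensionality_dep => P.
by apply/funext => x; apply/funext => M.
Qed.

Let addA : associative (fun a b : T => (fun P x M => a P x M + b P x M) : T).
Proof. by move=> a b c; apply: pf_ext => *; rewrite addrA. Qed.
Let addC : commutative (fun a b : T => (fun P x M => a P x M + b P x M) : T).
Proof. by move=> a b; apply: pf_ext => *; rewrite addrC. Qed.
Let add0 : left_id ((fun P x M => 0) : T)
  (fun a b : T => (fun P x M => a P x M + b P x M) : T).
Proof. by move=> a; apply: pf_ext => *; rewrite add0r. Qed.
Let addN : left_inverse ((fun P x M => 0) : T) (fun a : T => fun P x M => - a P x M)
  (fun a b : T => (fun P x M => a P x M + b P x M) : T).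
Proof. by move=> a; apply: pf_ext => *; rewrite addNr. Qed.

HB.instance Definition _ := GRing.isZmodule.Build T addA addC add0 addN.

Let scale (c : R) (a : T) : T := fun P x M => c * a P x M.
Let scaleA (c d : R) (a : T) : scale c (scale d a) = scale (c * d) a.
Proof. by apply: pf_ext => *; rewrite /scale mulrA. Qed.
Let scale1 : left_id 1 scale.
Proof. by move=> a; apply: pf_ext => *; rewrite /scale mul1r. Qed.
Let scaleDr : right_distributive scale +%R.
Proof. by move=> c a b; apply: pf_ext => *; rewrite /scale mulrDr. Qed.
Let scaleDl (a : T) : {morph scale^~ a : c d / c + d}.
Proof. by move=> c d; apply: pf_ext => *; rewrite /scale mulrDl. Qed.

HB.instance Definition _ := GRing.Zmodule_isLmodule.Build R T
  scaleA scale1 scaleDr scaleDl.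

Lemma preform_ext (a b : T) : (forall P x M, a P x M = b P x M) -> a = b.
Proof. exact: pf_ext. Qed.

Lemma preform_linE c (a b : T) P x M :
  (c *: a + b) P x M = c * a P x M + b P x M.
Proof. by []. Qed.
End PreformLmodule.

Section Forms.
Context {R : realType} {p : nat} {X : diffeologicalType R}.

(* The last condition is a(P o F) = F^* a(P): the rows of M *m J are the images
   under the differential of F at y of the rows of M. *)
Definition is_form (a : preform p X) : Prop :=
  [/\ forall P x, multilinear_rows (a P x),
      forall P x, antisymmetric_rows (a P x),
      forall P M, smooth (fun x => a P x M : R^o) &
      forall (P : plot X) m (V : set 'rV[R]_m) (F : V -> pdom P)
          (oV : open V) (sF : smooth (set_val \o F)) (y : V) (M : 'M[R]_(p, m)),
        a (plot_comp oV sF) y M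
          = a P (F y) (M *m 'J ('valL_0 (set_val \o F)) (set_val y))].

Definition form_pred : {pred preform p X} := fun a => `[< is_form a >].

Lemma form_submod : submod_closed form_pred.
Proof.
split=> [|c a b /asboolP[la sa ma na] /asboolP[lb sb mb nb]]; apply/asboolP.
  split=> //; first by move=> P x i c M A B _ _ _; rewrite mulr0 addr0.
    by move=> P x i j M _; rewrite oppr0.
  by move=> P M; apply: smooth_cst; exact: is_plot_open (plotP P).
split.
- move=> P x i d M A B h1 h2 h3; rewrite !preform_linE.
  rewrite (la P x i d M A B)// (lb P x i d M A B)//.
  by rewrite !mulrDr addrACA mulrCA.
- by move=> P x i j M ij; rewrite !preform_linE sa// sb// mulrN opprD.
- move=> P M; have oP := is_plot_open (plotP P).
  exact: (smooth_linear c oP (ma P M) (mb P M)).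
- by move=> P m V F oV sF y M; rewrite !preform_linE na nb.
Qed.

HB.instance Definition _ := GRing.isSubmodClosed.Build R (preform p X) form_pred
  form_submod.
End Forms.

Record form (R : realType) (p : nat) (X : diffeologicalType R) := Form {
  form_val : preform p X;
  form_valP : form_val \in form_pred
}.
Arguments form_val {R p X} f.
Arguments form_valP {R p X} f.

HB.instance Definition _ (R : realType) p (X : diffeologicalType R) :=
  [isSub for @form_val R p X].
HB.instance Definition _ (R : realType) p (X : diffeologicalType R) :=
  [Choice of form p X by <:].
HB.instance Definition _ (R : realType) p (X : diffeologicalType R) :=
  [SubChoice_isSubLmodule of form p X by <:].

Section ExteriorDerivative.
Context {R : realType} {p : nat} {X : diffeologicalType R}.

(* (d a)(P) = d (a(P)).  The target is stated as the ambient space of preforms: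
   that d a satisfies is_form again is a theorem, which is not needed in order
   to form Ker d and Im d. *)
Definition ext_d (a : form p X) : preform p.+1 X := fun P => ext_deriv (form_val a P).

Lemma ext_d_linear : linear ext_d.
Proof.
move=> c a b; apply: preform_ext => P x M.
rewrite preform_linE /ext_d /ext_deriv mulr_sumr -big_split /=.
apply: eq_bigr => i _; rewrite mulrCA -mulrDr; congr (_ * _).
have /asboolP[_ _ /(_ P (row' i M)) sa _] := form_valP a.
have /asboolP[_ _ /(_ P (row' i M)) sb _] := form_valP b.
have da := smooth_differentiable x sa.
have db := smooth_differentiable x sb.
set f := fun y : pdom P => form_val a P y (row' i M) : R^o.
set g := fun y : pdom P => form_val b P y (row' i M) : R^o.
have -> : 'valL_0 (fun y : pdom P => form_val (c *: a + b) P y (row' i M) : R^o)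
    = c *: 'valL_0 f + 'valL_0 g by rewrite -valL0_linear.
by rewrite diffD ?diffZ//; exact: differentiableZ.
Qed.

HB.instance Definition _ := GRing.isLinear.Build R (form p X) (preform p.+1 X)
  *:%R ext_d ext_d_linear.
End ExteriorDerivative.

Section DeRham.
Context {R : realType}.

Definition cocycle_pred p (X : diffeologicalType R) : {pred form p X} :=
  fun a => ext_d a == 0.

Lemma cocycle_submod p (X : diffeologicalType R) :
  submod_closed (@cocycle_pred p X).
Proof.
split=> [|c a b /eqP da /eqP db]; apply/eqP; first exact: linear0.
by rewrite ext_d_linear da db scaler0 addr0.
Qed.

HB.instance Definition _ p (X : diffeologicalType R) :=
  GRing.isSubmodClosed.Build R (form p X) (@cocycle_pred p X)
    (@cocycle_submod p X).
End DeRham.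

Record cocycle (R : realType) (p : nat) (X : diffeologicalType R) := Cocycle {
  cocycle_val : form p X;
  cocycle_valP : cocycle_val \in @cocycle_pred R p X
}.
Arguments cocycle_val {R p X} c.

HB.instance Definition _ (R : realType) p (X : diffeologicalType R) :=
  [isSub for @cocycle_val R p X].
HB.instance Definition _ (R : realType) p (X : diffeologicalType R) :=
  [Choice of cocycle p X by <:].
HB.instance Definition _ (R : realType) p (X : diffeologicalType R) :=
  [SubChoice_isSubLmodule of cocycle p X by <:].

Section Exact.
Context {R : realType}.

(* For p = 0, Omega^{-1}(X) = 0. *)
Definition is_exact p (X : diffeologicalType R) : form p X -> Prop :=
  match p return form p X -> Prop with
  | 0 => fun a => a = 0
  | q.+1 => fun a => exists b : form q X, form_val a = ext_d b
  end.

Definition coboundary_pred p (X : diffeologicalType R) : {pred cocycle p X} :=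
  fun a => `[< is_exact (cocycle_val a) >].

Lemma coboundary_submod p (X : diffeologicalType R) :
  submod_closed (@coboundary_pred p X).
Proof.
split=> [|c a b /asboolP ea /asboolP eb]; apply/asboolP.
  by case: p => [|p] //=; exists 0; rewrite linear0.
case: p a b ea eb => [|p] a b /=; first by move=> -> ->; rewrite scaler0 addr0.
by move=> [a' ->] [b' ->]; exists (c *: a' + b'); rewrite ext_d_linear.
Qed.

HB.instance Definition _ p (X : diffeologicalType R) :=
  GRing.isSubmodClosed.Build R (cocycle p X) (@coboundary_pred p X)
    (@coboundary_submod p X).
End Exact.

Definition deRham (R : realType) (p : nat) (X : diffeologicalType R) : Type :=
  Quotient.quot [the zmodClosed (cocycle p X) of @coboundary_pred R p X].

Section DeRhamLmodule.
Local Open Scope quotient_scope.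
Context {R : realType} {p : nat} {X : diffeologicalType R}.
Local Notation H := (deRham p X).
Local Notation Q :=
  (Quotient.quot [the zmodClosed (cocycle p X) of @coboundary_pred R p X]).

HB.instance Definition _ := GRing.Zmodule.copy H Q.

Definition cohomology_class (a : cocycle p X) : H := \pi_Q a.

Lemma cohomology_classE (a b : cocycle p X) :
  cohomology_class a = cohomology_class b <->
  is_exact (cocycle_val (a - b)).
Proof.
split=> [/eqP|e]; first by rewrite /cohomology_class -Quotient.idealrBE => /asboolP.
by apply/eqP; rewrite /cohomology_class -Quotient.idealrBE; apply/asboolP.
Qed.

Lemma cohomology_class_repr (c : H) : cohomology_class (repr (c : Q)) = c.
Proof. exact: reprK. Qed.

Lemma cohomology_classD (a b : cocycle p X) :
  cohomology_class (a + b) = cohomology_class a + cohomology_class b.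
Proof. exact: (raddfD \pi_Q). Qed.

Let scale (c : R) (h : H) : H := cohomology_class (c *: repr (h : Q)).

Let scale_class c (a : cocycle p X) :
  scale c (cohomology_class a) = cohomology_class (c *: a).
Proof.
apply/cohomology_classE; rewrite -scalerBr.
have /cohomology_classE/asboolP e :=
  cohomology_class_repr (cohomology_class a).
by apply/asboolP; exact: (@rpredZ _ _ (@coboundary_pred R p X) c _ e).
Qed.

Let scaleA c d h : scale c (scale d h) = scale (c * d) h.
Proof. by rewrite -(cohomology_class_repr h) !scale_class scalerA. Qed.
Let scale1 : left_id 1 scale.
Proof. by move=> h; rewrite -(cohomology_class_repr h) scale_class scale1r. Qed.
Let scaleDr : right_distributive scale +%R.
Proof.
move=> c h k; rewrite -(cohomology_class_repr h) -(cohomology_class_repr k).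
by rewrite -cohomology_classD !scale_class scalerDr cohomology_classD.
Qed.
Let scaleDl h : {morph scale^~ h : c d / c + d}.
Proof.
move=> c d; rewrite -(cohomology_class_repr h).
by rewrite !scale_class scalerDl cohomology_classD.
Qed.

HB.instance Definition _ := GRing.Zmodule_isLmodule.Build R H
  scaleA scale1 scaleDr scaleDl.

Lemma cohomology_class_linear : linear cohomology_class.
Proof. by move=> c a b; rewrite cohomology_classD -scale_class. Qed.

HB.instance Definition _ := GRing.isLinear.Build R (cocycle p X) H *:%R
  cohomology_class cohomology_class_linear.
End DeRhamLmodule.

Section Pullback.
Context {R : realType} {p : nat} {X Y : diffeologicalType R}.
Variable f : smooth_map X Y.

Definition preform_pull (a : preform p Y) : preform p X :=
  fun P => a (plot_push f P).

Lemma preform_pull_form (a : preform p Y) :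
  a \in form_pred -> preform_pull a \in form_pred.
Proof.
move=> /asboolP[la sa ma na]; apply/asboolP; split.
- by move=> P; exact: (la (plot_push f P)).
- by move=> P; exact: (sa (plot_push f P)).
- by move=> P; exact: (ma (plot_push f P)).
move=> P m V F oV sF y M.
rewrite -[RHS](na (plot_push f P) m V F oV sF y M) /preform_pull.
have E (g : V -> Y) (g1 g2 : is_plot V g) : a (Plot g1) y M = a (Plot g2) y M.
  by rewrite (Prop_irrelevance g1 g2).
exact: E.
Qed.

Definition form_pull (a : form p Y) : form p X :=
  Form (preform_pull_form (form_valP a)).

Lemma form_pull_linear : linear form_pull.
Proof. by move=> c a b; apply: val_inj. Qed.

HB.instance Definition _ := GRing.isLinear.Build R (form p Y) (form p X) *:%R
  form_pull form_pull_linear.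
End Pullback.

Section PullbackDeRham.
Context {R : realType} {X Y : diffeologicalType R}.
Variable f : smooth_map X Y.

Lemma ext_d_pull p (a : form p Y) : ext_d (form_pull f a) = preform_pull f (ext_d a).
Proof. by []. Qed.

Lemma form_pull_cocycle p (a : form p Y) :
  a \in @cocycle_pred R p Y -> form_pull f a \in @cocycle_pred R p X.
Proof. by move=> /eqP da; apply/eqP; rewrite ext_d_pull da. Qed.

Lemma form_pull_exact p (a : form p Y) :
  is_exact a -> is_exact (form_pull f a).
Proof.
case: p a => [|p] a /=; first by move=> ->; rewrite linear0.
by move=> [b ab]; exists (form_pull f b); rewrite ext_d_pull -ab.
Qed.

Definition cocycle_pull p (a : cocycle p Y) : cocycle p X :=
  Cocycle (form_pull_cocycle (cocycle_valP a)).

Lemma cocycle_pull_linear p : linear (@cocycle_pull p).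
Proof. by move=> c a b; apply/val_inj/val_inj. Qed.

HB.instance Definition _ p := GRing.isLinear.Build R (cocycle p Y) (cocycle p X)
  *:%R (@cocycle_pull p) (@cocycle_pull_linear p).

Definition deRham_pull p (h : deRham p Y) : deRham p X :=
  cohomology_class (cocycle_pull (repr (h : Quotient.quot _))).

Lemma deRham_pull_class p (a : cocycle p Y) :
  deRham_pull (cohomology_class a) = cohomology_class (cocycle_pull a).
Proof.
apply/cohomology_classE.
have /cohomology_classE/form_pull_exact :=
  cohomology_class_repr (cohomology_class a).
by rewrite -linearB.
Qed.

Lemma deRham_pull_linear p : linear (@deRham_pull p).
Proof.
move=> c h k; rewrite -(cohomology_class_repr h) -(cohomology_class_repr k).
by rewrite -linearP !deRham_pull_class !linearP.
Qed.

HB.instance Definition _ p := GRing.isLinear.Build R (deRham p Y) (deRham p X)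
  *:%R (@deRham_pull p) (@deRham_pull_linear p).
End PullbackDeRham.
Arguments deRham_pull {R X Y} f p h.

Section MayerVietorisMaps.
Context {R : realType} {X : diffeologicalType R} (A B : set X) (p : nat).

Definition mv_restrict (w : deRham p X) : (deRham p A * deRham p B)%type :=
  (deRham_pull (incl_space A) p w, deRham_pull (incl_space B) p w).

Definition mv_difference (ab : (deRham p A * deRham p B)%type) :
    deRham p (A `&` B) :=
  deRham_pull (incl_sub (@subIsetl _ A B)) p ab.1
  - deRham_pull (incl_sub (@subIsetr _ A B)) p ab.2.
End MayerVietorisMaps.

Definition exact_at (U V W : zmodType) (f : U -> V) (g : V -> W) : Prop :=
  range f = [set v | g v = 0].

(* Main.v *)
Require Import Defs.
From HB Require Import structures.
From mathcomp Require Import fingroup perm.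
From mathcomp Require Import all_boot all_order all_algebra.
From mathcomp Require Import all_classical all_reals all_analysis.
From mathcomp Require Import zify.
Import Order.TTheory GRing.Theory Num.Theory.
Import numFieldNormedType.Exports.
(* [form] is the type of differential forms, not that of sesquilinear forms. *)
Import Defs.
Set Implicit Arguments.
Unset Strict Implicit.
Unset Printing Implicit Defensive.
Local Open Scope classical_set_scope.
Local Open Scope ring_scope.

(** The sequence is the long exact sequence of the short exact sequence of
    complexes 0 -> Omega(X) -> Omega(A) (+) Omega(B) -> Omega(A n B) -> 0.
    Exactness on the left and in the middle is gluing of forms: a plot of X
    restricts to plots of A and B on two open sets covering its domain.
    Surjectivity on the right comes from the partition of unity: eta is the
    difference of phi_B eta, extended by 0 to A, and - phi_A eta, extended by 0
    to B.  For d(phi eta) to be a form again it suffices that d eta is one, since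
    d(phi eta) = d phi /\ eta + phi d eta and the wedge product with d phi is
    visibly natural; in every use below, d eta is either 0 or given as a form.
    The connecting map relates w to g when w = a - b on A n B, and g = da on A,
    g = db on B.  That g is closed is d o d = 0, i.e. Schwarz's theorem. *)

(** * Symmetry of second derivatives and d o d = 0 *)

Section Schwarz.
Context {R : realType} {V : normedModType R}.
Implicit Types (f : V -> R^o) (U : set V).

Lemma is_derive_line f (c u : V) (s : R) :
  differentiable f (c + s *: u) ->
  is_derive (s : R^o) 1 (fun t : R^o => f (c + t *: u)) ('d f (c + s *: u) u).
Proof.
move=> df.
have dl : is_diff (s : R^o) (fun t : R^o => c + t *: u) ( *:%R ^~ u : R^o -> V).
  have := is_diffD (is_diff_cst c (s : R^o)) (is_diff_scalel s u).
  by rewrite add0r.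
have dfl : is_diff (c + s *: u) f ('d f (c + s *: u)) by apply: DiffDef.
have dc := is_diff_comp dl dfl.
apply: DeriveDef; first exact/diff_derivable/(@ex_diff _ _ _ _ _ _ _ dc).
rewrite deriveE; last exact: (@ex_diff _ _ _ _ _ _ _ dc).
by rewrite (@diff_val _ _ _ _ _ _ _ dc) /= scale1r.
Qed.

(* The second difference is a value of the mixed derivative, by the mean value
   theorem applied first along [u], then along [v]. *)
Lemma second_difference f U (x u v : V) (h : R) :
  Ck 2 U f -> 0 < h ->
  (forall s t, 0 <= s <= h -> 0 <= t <= h -> U (x + s *: u + t *: v)) ->
  exists s t, [/\ 0 <= s <= h, 0 <= t <= h &
    f (x + h *: u + h *: v) - f (x + h *: u) - (f (x + h *: v) - f x)
    = 'd (fun y => 'd f y u : R^o) (x + s *: u + t *: v) v * h * h].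
Proof.
move=> [df Cf] h0 Uh.
have [df' _] := Cf u.
have hh : 0 <= h <= h by rewrite lexx (ltW h0).
have h00 : 0 <= (0 : R) <= h by rewrite lexx (ltW h0).
have Us s : 0 <= s <= h -> U (x + s *: u).
  by move=> hs; have := Uh _ _ hs h00; rewrite scale0r addr0.
have d1 (s : R) : 0 <= s <= h -> is_derive (s : R^o) 1
    (fun t : R^o => f (x + h *: v + t *: u) - f (x + t *: u) : R^o)
    ('d f (x + h *: v + s *: u) u - 'd f (x + s *: u) u).
  move=> hs; apply: is_deriveB; apply: is_derive_line; apply: df.
    by rewrite addrAC; exact: Uh.
  exact: Us.
have [| |s] := @MVT _ (fun t : R^o => f (x + h *: v + t *: u) - f (x + t *: u))
  (fun s => 'd f (x + h *: v + s *: u) u - 'd f (x + s *: u) u) 0 h h0.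
- by move=> s /[!in_itv]/= /andP[s0 sh]; apply: d1; rewrite !ltW.
- apply: continuous_in_subspaceT => s /[!inE]/= /[!in_itv]/= hs.
  have D := d1 s hs; apply: differentiable_continuous.
  by apply/derivable1_diffP; exact: (@ex_derive _ _ _ _ _ _ _ D).
rewrite in_itv/= => /andP[s0 sh] E1.
have hs : 0 <= s <= h by rewrite !ltW.
have d2 (t : R) : 0 <= t <= h -> is_derive (t : R^o) 1
    (fun t : R^o => 'd f (x + s *: u + t *: v) u : R^o)
    ('d (fun y => 'd f y u : R^o) (x + s *: u + t *: v) v).
  by move=> ht; apply: is_derive_line; apply: df'; exact: Uh.
have [| |t] := @MVT _ (fun t : R^o => 'd f (x + s *: u + t *: v) u)
  (fun t => 'd (fun y => 'd f y u : R^o) (x + s *: u + t *: v) v) 0 h h0.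
- by move=> t /[!in_itv]/= /andP[t0 th]; apply: d2; rewrite !ltW.
- apply: continuous_in_subspaceT => t /[!inE]/= /[!in_itv]/= ht.
  have D := d2 t ht; apply: differentiable_continuous.
  by apply/derivable1_diffP; exact: (@ex_derive _ _ _ _ _ _ _ D).
rewrite in_itv/= => /andP[t0 th] E2.
exists s, t; split; rewrite ?hs ?ltW//.
move: E1 E2; rewrite !scale0r !addr0 subr0 => E1 E2.
rewrite [x + s *: u + h *: v]addrAC in E2; rewrite -E2 -E1.
rewrite [x + h *: u + h *: v]addrAC; set a := f _; set b := f _; set c := f _.
by rewrite !opprB addrA.
Qed.

(** The second difference is symmetric in [u] and [v], and divided by h^2 it is a value of either
    mixed derivative near [x]. Both are continuous at [x], so they agree there. *)
Lemma diff_diffC f U (x u v : V) : open U -> Ck 2 U f -> U x ->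
  'd (fun y => 'd f y u : R^o) x v = 'd (fun y => 'd f y v : R^o) x u.
Proof.
move=> oU Cf Ux.
pose g w z := fun y => 'd (fun y => 'd f y w : R^o) y z : R^o.
have cg w z : {for x, continuous (g w z)}.
  by have [_ /(_ w)[_ /(_ z)]] := Cf; apply.
suff H (e : R) : 0 < e -> `|g u v x - g v u x| <= e.
  apply/eqP; rewrite -subr_eq0 -normr_le0; apply/ler_addgt0Pl => e e0.
  by rewrite addr0; exact: H.
move=> e0.
have e20 : 0 < e / 2 by rewrite divr_gt0.
have N : \forall y \near x, [/\ U y, `|g u v x - g u v y| < e / 2 &
    `|g v u x - g v u y| < e / 2].
  near=> y; split; near: y.
  - exact: open_nbhs_nbhs.
  - exact: (@cvgr_dist_lt _ _ _ _ _ _ _ (cg u v)).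
  - exact: (@cvgr_dist_lt _ _ _ _ _ _ _ (cg v u)).
have [r /= r0 Br] := (nbhs_ballP _ _).1 N.
(* The parallelogram with sides [h *: u] and [h *: v] then fits in the ball of radius [r]; the 1
   keeps the denominator positive when [u] and [v] vanish. *)
pose h := r / (`|u| + `|v| + 1).
have D0 : 0 < `|u| + `|v| + 1 by rewrite ltr_wpDl// addr_ge0.
have h0 : 0 < h by rewrite divr_gt0.
have hr s t : 0 <= s <= h -> 0 <= t <= h ->
    ball x r (x + s *: u + t *: v).
  move=> /andP[s0 sh] /andP[t0 th]; rewrite -ball_normE /ball_/=.
  rewrite -addrA opprD addrA subrr add0r normrN.
  apply: (le_lt_trans (ler_normD _ _)); rewrite !normrZ !ger0_norm//.
  apply: (@le_lt_trans _ _ (h * (`|u| + `|v|))).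
    by rewrite mulrDr lerD// ler_wpM2r.
  have -> : r = h * (`|u| + `|v| + 1) by rewrite divfK// gt_eqF.
  by rewrite ltr_pM2l// ltrDl.
have Us s t : 0 <= s <= h -> 0 <= t <= h -> U (x + s *: u + t *: v).
  by move=> hs ht; have [] := Br _ (hr _ _ hs ht).
have Us' t s : 0 <= t <= h -> 0 <= s <= h -> U (x + t *: v + s *: u).
  by move=> ht hs; rewrite addrAC; exact: Us.
have [s [t [hs ht E]]] := second_difference Cf h0 Us.
have [t' [s' [ht' hs' E']]] := second_difference Cf h0 Us'.
have [_ H1 _] := Br _ (hr _ _ hs ht).
have [_ _] := Br _ (hr _ _ hs' ht').
rewrite addrAC => H2.
have G : g u v (x + s *: u + t *: v) = g v u (x + t' *: v + s' *: u).
  apply: (@mulIf _ h); first by rewrite gt_eqF.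
  apply: (@mulIf _ h); first by rewrite gt_eqF.
  rewrite -E -E' [x + h *: v + h *: u]addrAC !opprB.
  by rewrite addrACA [RHS]addrACA; congr (_ + _); rewrite addrC.
rewrite (le_trans (ler_distD (g u v (x + s *: u + t *: v)) _ _))//.
by rewrite [leRHS]splitr lerD ?ltW// G distrC.
Unshelve. all: by end_near. Qed.
End Schwarz.

(** * Cancellation in alternating double sums *)

Section SignedSums.
Context {R : numDomainType}.

(** Here [j] is the position of [k] once [i] is deleted, and [j'] that of [i] once [k] is deleted.
    The two cases are i < k and k < i. *)
Lemma bump_exchangeP (i j k j' : nat) : k = bump i j -> i = bump k j' ->
  [/\ i <= j, k = j.+1 & j' = i]%N \/ [/\ j < i, k = j & i = j'.+1]%N.
Proof.
rewrite /bump; case: (leqP i j) => ij -> /=; case: leqP => jj' /= E;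
  by [left; split; lia | right; split; lia | exfalso; lia].
Qed.

Lemma bump_exchange (i j k j' l : nat) :
  k = bump i j -> i = bump k j' -> bump i (bump j l) = bump k (bump j' l).
Proof.
move=> kE iE; rewrite bumpC -kE; congr (bump k (bump _ l)).
have [[ij _ ->]|[ij _ ij']] := bump_exchangeP kE iE.
  by rewrite /unbump ltnNge ij subn0.
by rewrite /unbump ij ij' subn1.
Qed.

Lemma signr_bump_exchange (i j k j' : nat) : k = bump i j -> i = bump k j' ->
  (-1) ^+ i * (-1) ^+ j = - ((-1) ^+ k * (-1) ^+ j') :> R.
Proof.
move=> kE iE; have [[ij -> ->]|[ij -> ->]] := bump_exchangeP kE iE.
  by rewrite exprS mulN1r mulNr opprK mulrC.
by rewrite exprS mulN1r mulNr mulrC.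
Qed.

(** Indexed by ordered pairs (i, k) of distinct indices instead of (i, j), the summand changes sign
    when i and k are swapped, by [signr_bump_exchange]. The sum is therefore its own opposite. *)
Lemma signed_double_sum_eq0 n (G : 'I_n.+2 -> 'I_n.+1 -> R) :
  (forall i j k j', k = lift i j -> i = lift k j' -> G i j = G k j') ->
  \sum_(i < n.+2) (-1) ^+ i * (\sum_(j < n.+1) (-1) ^+ j * G i j) = 0.
Proof.
move=> Gsym.
(* The value 0 on the diagonal lets [H] be summed over the full square. *)
pose H (i k : 'I_n.+2) :=
  if unlift i k is Some j then (-1) ^+ i * (-1) ^+ j * G i j else 0.
have HN i k : H i k = - H k i.
  rewrite /H; case: unliftP => [j kE|->]; last by rewrite unlift_none oppr0.
  case: unliftP => [j' iE|iE].
    rewrite (Gsym _ _ _ _ kE iE) -mulNr; congr (_ * _).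
    by apply: signr_bump_exchange; [rewrite kE | rewrite iE].
  by have := neq_lift i j; rewrite -kE iE eqxx.
have SE : \sum_(i < n.+2) (-1) ^+ i * (\sum_(j < n.+1) (-1) ^+ j * G i j)
    = \sum_i \sum_k H i k.
  apply: eq_bigr => i _; rewrite mulr_sumr (bigD1_ord i)//= {1}/H unlift_none.
  by rewrite add0r; apply: eq_bigr => j _; rewrite /H liftK mulrA.
rewrite SE; apply/eqP; rewrite -eqNr -sumrN [X in _ == X]exchange_big/=.
apply/eqP; apply: eq_bigr => i _; rewrite -sumrN.
by apply: eq_bigr => k _; rewrite [RHS]HN.
Qed.
End SignedSums.

Section IteratedDerivative.
Context {R : realType} {n : nat}.

Lemma diff_lincomb (V : normedModType R) k (f : 'I_k -> V -> R^o)
    (c : 'I_k -> R) x :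
  (forall i, differentiable (f i) x) ->
  differentiable (\sum_i c i *: f i) x /\
  'd (\sum_i c i *: f i) x = (fun v => \sum_i c i * 'd (f i) x v) :> (V -> R^o).
Proof.
move=> df.
have D i : is_diff x (c i *: f i) (c i *: ('d (f i) x : V -> R^o)).
  by apply: is_diffZ; apply: DiffDef.
have : is_diff x (\sum_i c i *: f i) (\sum_i c i *: ('d (f i) x : V -> R^o)).
  elim/big_ind2: _ => [|????|i _]; [|exact: is_diffD|exact: D].
  exact: is_diff_cst.
case=> D1 ->; split=> //; apply/funext => v; rewrite fct_sumE.
by apply: eq_bigr.
Qed.

(** The left side is a signed double sum of second derivatives of coefficients of [w] with two rows
    of [M] deleted. The order of deletion does not matter, nor that of differentiation by Schwarz,
    so the terms cancel in pairs. *)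
Lemma ext_deriv_ext_deriv p (U : set 'rV[R]_n) (w : U -> 'M[R]_(p, n) -> R)
    (x : U) (M : 'M[R]_(p.+2, n)) :
  open U -> (forall N, smooth (fun y => w y N : R^o)) ->
  ext_deriv (ext_deriv w) x M = 0.
Proof.
move=> oU sw; rewrite /ext_deriv.
pose f N : 'rV[R]_n -> R^o := 'valL_0 (fun y : U => w y N : R^o).
have C2 N : Ck 2 U (f N) by exact: sw.
have Ux : U (set_val x) by exact: set_valP.
pose g N v : 'rV[R]_n -> R^o := fun y => 'd (f N) y v.
have dg N v : differentiable (g N v) (set_val x).
  by have [_ /(_ v)[+ _]] := C2 N; apply.
pose N i j := row' j (row' i M) : 'M[R]_(p, n).
rewrite -[RHS](signed_double_sum_eq0 (n := p)
  (G := fun i j => 'd (g (N i j) (row j (row' i M))) (set_val x) (row i M))).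
  apply: eq_bigr => i _; congr (_ * _).
  set h := 'valL_0 _.
  have [D E] := diff_lincomb (f := fun j => g (N i j) (row j (row' i M)))
    (fun j : 'I_p.+1 => (-1) ^+ j) (fun j => dg _ _).
  (* The extension by 0 of the inner derivative agrees with the linear combination on [U] only,
     which suffices as [U] is open. *)
  have hE : \forall y \near set_val x, (\sum_(j < p.+1)
      (-1) ^+ j *: g (N i j) (row j (row' i M)) : 'rV[R]_n -> R^o) y = h y.
    apply: filterS (open_nbhs_nbhs (conj oU Ux)) => y Uy.
    by rewrite /h (valL_Sub _ _ Uy) fct_sumE; apply: eq_bigr.
  by have [_ ->] := near_eq_diff hE D; rewrite E.
move=> i j k j' kE iE.
have NE : N k j' = N i j.
  apply/matrixP => l m; rewrite !mxE; congr (M _ _); apply: val_inj => /=.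
  by apply/esym/bump_exchange; [rewrite kE | rewrite iE].
have rE i1 j1 : row j1 (row' i1 M) = row (lift i1 j1) M.
  by apply/rowP => m; rewrite !mxE.
rewrite NE !rE -kE -iE; exact: (diff_diffC _ _ oU (C2 _) Ux).
Qed.
End IteratedDerivative.

(** * Locality of forms *)

Section Inclusions.
Context {R : realType} {n : nat}.

Lemma valL_out (T W : Type) (U : set T) (w : W) (f : U -> W) (x : T) :
  ~ U x -> 'valL_w f x = w.
Proof.
by move=> Ux; rewrite /valL_ /= oinv_set_val insubN //; apply/negP => /set_mem.
Qed.

(** From here on an inclusion of [V] into [U] is any [F] that commutes with [set_val]; this covers
    [set_incl] and the identity alike. *)
Lemma valL_restrict (W : normedModType R) (V U : set 'rV[R]_n) (f : U -> W)
    (F : V -> U) (z : 'rV[R]_n) :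
  (forall z, set_val (F z) = set_val z) -> V z ->
  'valL_0 (f \o F) z = 'valL_0 f z.
Proof.
move=> FE Vz; rewrite (valL_Sub _ (f \o F) Vz) /= -(valL_val 0 f) FE.
by [].
Qed.

Lemma Ck_subset k (W : normedModType R) (V U : set 'rV[R]_n) (f : 'rV[R]_n -> W) :
  V `<=` U -> Ck k U f -> Ck k V f.
Proof.
move=> VU; elim: k f => [|k IH] f /=; first by move=> cf x /VU; exact: cf.
by move=> [df Cf]; split=> [x /VU|v]; [exact: df | exact: IH].
Qed.

Lemma smooth_restrict (W : normedModType R) (V U : set 'rV[R]_n) (f : U -> W)
    (F : V -> U) :
  open V -> (forall z, set_val (F z) = set_val z) -> smooth f -> smooth (f \o F).
Proof.
move=> oV FE sf k; apply: (@Ck_ext _ _ _ _ V ('valL_0 f)) => //.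
  by move=> x Vx; rewrite (valL_restrict f FE Vx).
apply: Ck_subset (sf k) => x Vx.
have -> : x = set_val (F (SigSub (mem_set Vx))) by rewrite FE.
exact: set_valP.
Qed.

Lemma is_diff_val (V U : set 'rV[R]_n) (F : V -> U) (y : V) :
  open V -> (forall z, set_val (F z) = set_val z) ->
  is_diff (set_val y) ('valL_0 (set_val \o F)) id.
Proof.
move=> oV FE.
have idE : \forall z \near set_val y, id z = 'valL_0 (set_val \o F) z.
  apply: filterS (open_nbhs_nbhs (conj oV (set_valP y))) => z Vz.
  by rewrite (valL_Sub _ _ Vz) /= FE.
have [D E] := near_eq_diff idE (@ex_diff _ _ _ _ _ _ _ (is_diff_id (set_val y))).
apply: DiffDef; first exact: D.
by rewrite E; exact: (@diff_val _ _ _ _ _ _ _ (is_diff_id (set_val y))).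
Qed.

Lemma smooth_val (V U : set 'rV[R]_n) (F : V -> U) :
  open V -> (forall z, set_val (F z) = set_val z) -> smooth (set_val \o F).
Proof.
move=> oV FE k; apply: (@Ck_ext _ _ _ _ V id) => // [x Vx|].
  by rewrite (valL_Sub _ _ Vx) /= FE.
elim: k => [|k IH]; first by move=> x _; exact: cvg_id.
split=> [x _|v]; first exact: (@ex_diff _ _ _ _ _ _ _ (is_diff_id x)).
rewrite (_ : (fun x => _) = cst v); first exact: Ck_cst.
by apply/funext => x; rewrite (@diff_val _ _ _ _ _ _ _ (is_diff_id x)).
Qed.

Lemma jacobian_val (V U : set 'rV[R]_n) (F : V -> U) (y : V) :
  open V -> (forall z, set_val (F z) = set_val z) ->
  'J ('valL_0 (set_val \o F)) (set_val y) = 1%:M.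
Proof.
move=> oV FE; apply/row_matrixP => i; rewrite !rowE mul_rV_lin1 /= mulmx1.
by rewrite (@diff_val _ _ _ _ _ _ _ (is_diff_val y oV FE)).
Qed.

Lemma ext_deriv_restrict p (U V : set 'rV[R]_n) (w : U -> 'M[R]_(p, n) -> R)
    (w' : V -> 'M[R]_(p, n) -> R) (F : V -> U) (y : V) M :
  open V -> (forall z, set_val (F z) = set_val z) ->
  (forall N, smooth (fun x => w x N : R^o)) ->
  (forall z N, w' z N = w (F z) N) -> ext_deriv w' y M = ext_deriv w (F y) M.
Proof.
move=> oV FE sw wE; rewrite /ext_deriv; apply: eq_bigr => i _.
have wE' : \forall z \near set_val y,
    'valL_0 (fun x => w x (row' i M) : R^o) z
    = 'valL_0 (fun z => w' z (row' i M) : R^o) z.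
  apply: filterS (open_nbhs_nbhs (conj oV (set_valP y))) => z Vz.
  rewrite -(valL_restrict (fun x => w x (row' i M) : R^o) FE Vz).
  by congr ('valL_0 _ z); apply/funext => z'; rewrite /= wE.
have := smooth_differentiable (F y) (sw (row' i M)); rewrite FE => dw.
by have [_ ->] := near_eq_diff wE' dw.
Qed.
End Inclusions.

Section Locality.
Context {R : realType} {X : diffeologicalType R}.

(** The naturality clause of [is_form] is tied to the proof term in [plot_comp]. By proof
    irrelevance it holds for every plot that agrees pointwise with [P \o F]. *)
Lemma form_natural p (a : form p X) (P : plot X) m (V : set 'rV[R]_m) (G : V -> X)
    (pG : is_plot V G) (F : V -> pdom P) (y : V) (M : 'M[R]_(p, m)) :
  smooth (set_val \o F) -> (forall z, G z = P (F z)) ->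
  form_val a (Plot pG) y M
  = form_val a P (F y) (M *m 'J ('valL_0 (set_val \o F)) (set_val y)).
Proof.
move=> sF GE; have /asboolP[_ _ _ na] := form_valP a.
have oV := is_plot_open pG; rewrite -(na P m V F oV sF) /plot_comp.
have {GE} GE : G = P \o F by exact/funext.
move: pG; rewrite GE => pG.
by rewrite (Prop_irrelevance pG (is_plot_comp (plotP P) oV sF)).
Qed.

(** Naturality under inclusions of open sets only. It is enough for comparing preforms on a cover,
    and it is available for [ext_d a], which is not known to be a form. *)
Definition local_preform p (a : preform p X) : Prop :=
  forall (P : plot X) (V : set 'rV[R]_(pdim P)) (G : V -> X) (pG : is_plot V G)
    (F : V -> pdom P), (forall z, set_val (F z) = set_val z) ->
    (forall z, G z = P (F z)) ->
    forall (y : V) (M : 'M[R]_(p, pdim P)), a (Plot pG) y M = a P (F y) M.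

Lemma form_local p (a : form p X) : local_preform (form_val a).
Proof.
move=> P V G pG F FE GE y M; have oV := is_plot_open pG.
by rewrite (form_natural _ _ _ _ (smooth_val oV FE) GE) jacobian_val// mulmx1.
Qed.

Lemma ext_d_local p (a : form p X) : local_preform (ext_d a).
Proof.
move=> P V G pG F FE GE y M.
have oV := is_plot_open pG.
have /asboolP[_ _ sa _] := form_valP a.
exact: (ext_deriv_restrict y M oV FE (sa P)
  (form_local a pG FE GE)).
Qed.
End Locality.

(** * Gluing along two open embeddings *)

Section OpenEmbedding.
Context {R : realType} {Y Z : diffeologicalType R}.

(** The common features of the inclusions of [A] and [B] in [X] and of the intersection in [A] and
    [B], so that gluing is done once for all of them. *)
Definition open_embedding (j : smooth_map Y Z) : Prop :=
  [/\ injective j,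
      forall n (U : set 'rV[R]_n) (P : U -> Y),
        is_plot U (j \o P) -> is_plot U P &
      Dopen (range j)].

Variables (j : smooth_map Y Z) (hj : open_embedding j).
Implicit Types P : plot Z.

Definition lift_dom (P : plot Z) : set 'rV[R]_(pdim P) :=
  set_val @` (P @^-1` range j).

Arguments lift_dom : clear implicits.

Lemma lift_dom_open P : open (lift_dom P).
Proof. by have [_ _ oj] := hj; exact: oj (plotP P). Qed.

Arguments lift_dom_open : clear implicits.

Lemma lift_domW P : lift_dom P `<=` pdom P.
Proof. by move=> _ [x _ <-]; exact: set_valP. Qed.

Arguments lift_domW : clear implicits.

Lemma lift_domP P (x : pdom P) : lift_dom P (set_val x) <-> range j (P x).
Proof. by split=> [[y + /val_inj <-]|?]//; exists x. Qed.

Lemma lift_ex P (x : lift_dom P) :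
  exists y : Y, j y = P (set_incl (lift_domW P) x).
Proof.
have [u [y _ yE] ux] := set_valP x.
by exists y; rewrite yE; congr (P _); exact: val_inj.
Qed.

Definition lift_fun P (x : lift_dom P) : Y := projT1 (cid (lift_ex x)).

Lemma lift_funE P (x : lift_dom P) :
  j (lift_fun x) = P (set_incl (lift_domW P) x).
Proof. by rewrite /lift_fun; case: cid. Qed.

Lemma lift_fun_plot P : is_plot (lift_dom P) (@lift_fun P).
Proof.
have [_ pj _] := hj; apply: pj.
rewrite (_ : _ \o _ = P \o set_incl (lift_domW P)); last first.
  by apply/funext => x; exact: lift_funE.

apply: (is_plot_comp (plotP P) (lift_dom_open P)).
exact: (smooth_val (lift_dom_open P)).
Qed.

Definition lift_plot P : plot Y := Plot (@lift_fun_plot P).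

Variables (p : nat) (a : form p Y).

(** The form [a] carried over to [Z] along [j]. It takes the default value 0 where [P] leaves the
    image of [j], so it need not be smooth on all of [pdom P]; it is meaningful on
    [lift_dom j P]. *)
Definition lift_form : preform p Z := fun P x M =>
  'valL_0 (fun y : lift_dom P => form_val a (lift_plot P) y M : R^o) (set_val x).

Arguments lift_form : clear implicits.

Lemma lift_formE P (x : lift_dom P) M :
  lift_form P (set_incl (lift_domW P) x) M = form_val a (lift_plot P) x M.
Proof. exact: (valL_val 0 (fun y => form_val a (lift_plot P) y M : R^o)). Qed.

Lemma lift_form_exE P (x : pdom P) : range j (P x) ->
  exists y : lift_dom P, x = set_incl (lift_domW P) y /\
    forall M, lift_form P x M = form_val a (lift_plot P) y M.
Proof.
move=> /lift_domP Px; exists (SigSub (mem_set Px)).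
have E : x = set_incl (lift_domW P) (SigSub (mem_set Px)) by exact: val_inj.
by split=> // M; rewrite {1}E lift_formE.
Qed.

(** As [j] is injective, [G] factors through the lift of [P], and naturality of [a] applies to this
    factorization. *)
Lemma lift_form_natural P m (V : set 'rV[R]_m) (G : V -> Y) (pG : is_plot V G)
    (F : V -> pdom P) (y : V) (M : 'M[R]_(p, m)) :
  smooth (set_val \o F) -> (forall z, j (G z) = P (F z)) ->
  form_val a (Plot pG) y M
  = lift_form P (F y) (M *m 'J ('valL_0 (set_val \o F)) (set_val y)).
Proof.
move=> sF GE; have oV := is_plot_open pG.
have FP z : lift_dom P (set_val (F z)).
  by apply/lift_domP; exists (G z) => //; exact: GE.
pose F' z : lift_dom P := SigSub (mem_set (FP z)).
have F'E z : F z = set_incl (lift_domW P) (F' z) by exact: val_inj.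
have GE' z : G z = lift_plot P (F' z).
  by have [ij _ _] := hj; apply: ij; rewrite GE F'E -lift_funE.
have FF' : set_val \o F' = set_val \o F by exact/funext.
rewrite (form_natural a (P := lift_plot P) pG (F := F') y M _ GE') ?FF'//.
by rewrite -lift_formE -F'E.
Qed.

Lemma lift_form_restrict P (V : set 'rV[R]_(pdim P)) (G : V -> Y)
    (pG : is_plot V G) (F : V -> pdom P) (y : V) (M : 'M[R]_(p, pdim P)) :
  (forall z, set_val (F z) = set_val z) -> (forall z, j (G z) = P (F z)) ->
  form_val a (Plot pG) y M = lift_form P (F y) M.
Proof.
move=> FE GE; have oV := is_plot_open pG.
rewrite (lift_form_natural _ _ _ (smooth_val oV FE) GE).
by rewrite jacobian_val// mulmx1.
Qed.

Lemma lift_form_comp P m (V : set 'rV[R]_m) (F : V -> pdom P) (oV : open V)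
    (sF : smooth (set_val \o F)) (y : V) (M : 'M[R]_(p, m)) :
  range j (P (F y)) ->
  lift_form (plot_comp oV sF) y M
  = lift_form P (F y) (M *m 'J ('valL_0 (set_val \o F)) (set_val y)).
Proof.
move=> PFy.
have [y' [yE ->]] := @lift_form_exE (plot_comp oV sF) y PFy.
have oW := lift_dom_open (plot_comp oV sF).
have incE (z : lift_dom (plot_comp oV sF)) :
  set_val (set_incl (lift_domW (plot_comp oV sF)) z) = set_val z by [].
(* The composite plot is lifted on an open neighbourhood of [y] only. Restricting [F] to it does not
   change the Jacobian at [y]. *)
pose F' := F \o set_incl (lift_domW (plot_comp oV sF)).
have nearF : \forall z \near set_val y,
    'valL_0 (set_val \o F) z = 'valL_0 (set_val \o F') z.
  have Wy : lift_dom (plot_comp oV sF) (set_val y).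
    by rewrite yE; exact: (set_valP y').
  apply: filterS (open_nbhs_nbhs (conj oW Wy)) => z Wz.
  by rewrite (valL_restrict (set_val \o F) incE Wz).
have sF' : smooth (set_val \o F') := smooth_restrict oW incE sF.
have FyE : F' y' = F y by rewrite yE.
have valyE : set_val y' = set_val y by rewrite yE.
have JE : 'J ('valL_0 (set_val \o F')) (set_val y')
        = 'J ('valL_0 (set_val \o F)) (set_val y).
  have [_ E] := near_eq_diff nearF (smooth_differentiable y sF).
  by rewrite valyE; exact: (congr1 (fun f => lin1_mx f) E).
rewrite -JE -FyE; apply: (lift_form_natural _ _ _ sF') => z.
exact: lift_funE.
Qed.
End OpenEmbedding.
Arguments lift_dom {R Y Z} j P _.
Arguments lift_domW {R Y Z j} P _ _.
Arguments lift_dom_open {R Y Z j} hj P.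
Arguments lift_plot {R Y Z j} hj P.
Arguments lift_form {R Y Z j} hj {p} a P x M.

Section TwoOpenEmbeddings.
Context {R : realType} {Y1 Y2 Z : diffeologicalType R}.
Variables (j1 : smooth_map Y1 Z) (j2 : smooth_map Y2 Z).
Hypotheses (h1 : open_embedding j1) (h2 : open_embedding j2).
Hypothesis cover : forall z, range j1 z \/ range j2 z.

(** Near [x] the plot [P] is [j] composed with a plot of [Y], and there locality reduces both values
    to the pullbacks along [j]. *)
Lemma preform_pull_eq p (a b : preform p Z) (P : plot Z) (x : pdom P) M
    (Y : diffeologicalType R) (j : smooth_map Y Z) (hj : open_embedding j) :
  local_preform a -> local_preform b ->
  preform_pull j a = preform_pull j b -> range j (P x) -> a P x M = b P x M.
Proof.
move=> la lb ab /(lift_domP j) Px; pose y : lift_dom j P := SigSub (mem_set Px).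
have -> : x = set_incl (lift_domW P) y by exact: val_inj.
have E (c : preform p Z) : local_preform c ->
    c P (set_incl (lift_domW P) y) M
    = @preform_pull _ _ _ _ j c (lift_plot hj P) y M.
  move=> lc; apply/esym.
  apply: (lc P _ _ (smooth_funP j (plotP (lift_plot hj P)))) => z //.
  exact: lift_funE.
by rewrite !E// ab.
Qed.

Lemma preform_separated p (a b : preform p Z) :
  local_preform a -> local_preform b ->
  preform_pull j1 a = preform_pull j1 b ->
  preform_pull j2 a = preform_pull j2 b ->
  a = b.
Proof.
move=> la lb ab1 ab2; apply: preform_ext => P x M.
by have [] := cover (P x); exact: preform_pull_eq.
Qed.

Section Glue.
Variables (p : nat) (a1 : form p Y1) (a2 : form p Y2).
(** Agreement on the overlap is tested on pairs of plots with the same image in [Z], which avoids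
    building the fibre product of [Y1] and [Y2]. *)
Hypothesis agree : forall n (U : set 'rV[R]_n) (G1 : U -> Y1) (G2 : U -> Y2)
  (p1 : is_plot U G1) (p2 : is_plot U G2),
  (forall x, j1 (G1 x) = j2 (G2 x)) ->
  forall x M, form_val a1 (Plot p1) x M = form_val a2 (Plot p2) x M.

Definition glue : preform p Z := fun P x M =>
  if pselect (range j1 (P x)) then lift_form h1 a1 P x M
  else lift_form h2 a2 P x M.
Arguments glue : clear implicits.

Lemma glue_left (P : plot Z) (x : pdom P) M :
  range j1 (P x) -> glue P x M = lift_form h1 a1 P x M.
Proof. by rewrite /glue; case: pselect. Qed.

Lemma glue_right (P : plot Z) (x : pdom P) M :
  range j2 (P x) -> glue P x M = lift_form h2 a2 P x M.
Proof.
rewrite /glue; case: pselect => //= Px1 Px2.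
(* On [N] the plot [P] has lifts to both sides, and these form a pair to which [agree] applies. *)
pose N := lift_dom j1 P `&` lift_dom j2 P.
have oN : open N by apply: openI; exact: lift_dom_open.
have N1 : N `<=` lift_dom j1 P by move=> z [].
have N2 : N `<=` lift_dom j2 P by move=> z [].
have NP : N `<=` pdom P by move=> z [/lift_domW].
pose G1 := @lift_fun _ _ _ j1 P \o set_incl N1.
pose G2 := @lift_fun _ _ _ j2 P \o set_incl N2.
have p1 : is_plot N G1.
  exact: (is_plot_comp (lift_fun_plot h1 P) oN (smooth_val oN _)).
have p2 : is_plot N G2.
  exact: (is_plot_comp (lift_fun_plot h2 P) oN (smooth_val oN _)).
have GE1 z : j1 (G1 z) = P (set_incl NP z).
  by rewrite /G1 /= lift_funE; congr (P _); exact: val_inj.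
have GE2 z : j2 (G2 z) = P (set_incl NP z).
  by rewrite /G2 /= lift_funE; congr (P _); exact: val_inj.
have Nx : N (set_val x) by split; exact/lift_domP.
have -> : x = set_incl NP (SigSub (mem_set Nx)) by exact: val_inj.
rewrite -(lift_form_restrict h1 a1 p1)// -(lift_form_restrict h2 a2 p2)//.
by apply: agree => z; rewrite GE1 GE2.
Qed.

(** Every clause of [is_form] is local, so each is inherited from whichever of [a1] and [a2] covers
    the point in question. *)
Lemma glue_form : glue \in form_pred.
Proof.
have /asboolP[l1 s1 m1 _] := form_valP a1.
have /asboolP[l2 s2 m2 _] := form_valP a2.
have loc (P : plot Z) (x : pdom P) : exists w : 'M[R]_(p, pdim P) -> R,
    [/\ forall M, glue P x M = w M, multilinear_rows w & antisymmetric_rows w].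
  have [Px|Px] := cover (P x).
    have [y [_ E]] := lift_form_exE h1 a1 Px.
    exists (form_val a1 (lift_plot h1 P) y).
    split; first by move=> M; rewrite glue_left.
      exact: (l1 (lift_plot h1 P) y).
    exact: (s1 (lift_plot h1 P) y).
  have [y [_ E]] := lift_form_exE h2 a2 Px.
  exists (form_val a2 (lift_plot h2 P) y); split.
  - by move=> M; rewrite glue_right.
  - exact: (l2 (lift_plot h2 P) y).
  - exact: (s2 (lift_plot h2 P) y).
apply/asboolP; split.
- move=> P x; have [w [E lw _]] := loc P x.
  by move=> i c M A B hM hA hB; rewrite !E; exact: (lw i c M A B).
- by move=> P x; have [w [E _ sw]] := loc P x => i j M ij; rewrite !E; exact: sw.
- move=> P M; have oP := is_plot_open (plotP P).
  apply: smooth_local => // x.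
  have [/(lift_domP j1) Px|/(lift_domP j2) Px] := cover (P x).
    exists (lift_dom j1 P), (lift_domW P); split=> //; first exact: lift_dom_open.
    rewrite (_ : _ \o _ = fun y => form_val a1 (lift_plot h1 P) y M : R^o).
      exact: (m1 (lift_plot h1 P)).
    apply/funext => y /=; rewrite glue_left ?lift_formE//.
    by apply/lift_domP; exact: (set_valP y).
  exists (lift_dom j2 P), (lift_domW P); split=> //; first exact: lift_dom_open.
  rewrite (_ : _ \o _ = fun y => form_val a2 (lift_plot h2 P) y M : R^o).
    exact: (m2 (lift_plot h2 P)).
  apply/funext => y /=; rewrite glue_right ?lift_formE//.
  by apply/lift_domP; exact: (set_valP y).
- move=> P m V F oV sF y M.
  have [Px|Px] := cover (P (F y)).
    by rewrite !glue_left// lift_form_comp.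
  by rewrite !glue_right// lift_form_comp.
Qed.

Lemma preform_pull_lift (Y : diffeologicalType R) (j : smooth_map Y Z)
    (hj : open_embedding j) (a : form p Y) (P : plot Y) x M :
  lift_form hj a (plot_push j P) x M = form_val a P x M.
Proof.
apply/esym; case: P x M => n U P pP x M.
exact: (@lift_form_restrict _ _ _ _ hj _ a (plot_push j (Plot pP)) U P pP id).
Qed.

Lemma glue_ex : exists c : form p Z, form_pull j1 c = a1 /\ form_pull j2 c = a2.
Proof.
exists (Form glue_form); split; apply: val_inj; apply: preform_ext => P x M.
  rewrite -[LHS]/(glue (plot_push j1 P) x M) glue_left; last by exists (P x).
  exact: preform_pull_lift.
rewrite -[LHS]/(glue (plot_push j2 P) x M) glue_right; last by exists (P x).
exact: preform_pull_lift.
Qed.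
End Glue.
End TwoOpenEmbeddings.

(** * Products of functions and forms *)

Section CovectorWedge.
Context {R : realType} {n : nat}.

(** Induction on the distance of the rows: with k = j - 1, the transposition (i j) is (k j)(i k)(k
    j), and three sign changes make one. *)
Lemma antisymmetric_adjacent p (w : 'M[R]_(p, n) -> R) :
  (forall (i j : 'I_p) M, j = i.+1 :> nat -> w (xrow i j M) = - w M) ->
  antisymmetric_rows w.
Proof.
move=> wadj i j M ij.
wlog {ij} ij : i j / (i < j)%N.
  move=> H; have [ij'|ji|/val_inj ij'] := ltngtP i j; first exact: H.
    by rewrite /xrow tpermC; exact: H.
  by rewrite ij' eqxx in ij.
have [d dE] : exists d, j = (i + d).+1 :> nat by exists (j - i.+1)%N; lia.
elim: d j M {ij} dE => [|d IH] j M dE; first by apply: wadj; rewrite dE addn0.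
have kp : (i + d.+1 < p)%N by rewrite (leq_trans _ (ltn_ord j))// dE.
pose k := Ordinal kp.
have E : tperm i j = (tperm k j * tperm i k * tperm k j)%g.
  have := tpermJ i k (tperm k j).
  rewrite tpermL tpermD; last 2 first.
  - by apply/eqP => /(congr1 val) /=; lia.
  - by apply/eqP => /(congr1 val) /=; lia.
  by rewrite conjgE tpermV mulgA => ->.
rewrite /xrow E !row_permM -!/(xrow _ _ _).
by rewrite wadj ?IH ?wadj ?opprK//= ?dE ?addnS.
Qed.

Variables (p : nat) (l : {linear 'rV[R]_n -> R^o}) (w : 'M[R]_(p, n) -> R).

(** The wedge product of the covector [l] with [w], with the sign convention of [ext_deriv]. *)
Definition covector_wedge (M : 'M[R]_(p.+1, n)) : R :=
  \sum_(k < p.+1) (-1) ^+ k * (l (row k M) * w (row' k M)).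

Lemma covector_wedge_multilinear :
  multilinear_rows w -> multilinear_rows covector_wedge.
Proof.
move=> lw i a M A B hM hA hB; rewrite /covector_wedge mulr_sumr -big_split /=.
apply: eq_bigr => k _.
(* The term k = i is linear in row i through [l], the deleted matrix being unaffected; the others
   are so through [w], where row i has become row [i']. *)
have [->|ki] := eqVneq k i.
  by rewrite hM hA hB linearP/= mulrDl mulrDr -mulrA mulrCA.
have rE N : row' i N = row' i M -> row k N = row k M.
  by move=> NM; apply/rowP => m; rewrite !mxE; apply: (row'_eq NM).
have [i' iE _] := unlift_some ki.
rewrite (lw i' a (row' k M) (row' k A) (row' k B)).
- by rewrite (rE _ hA) (rE _ hB) !mulrDr !(mulrCA _ a).
- have r'E N : row i' (row' k N) = row i N by rewrite row_rowsub -iE.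
  by rewrite !r'E.
- apply/matrixP => r m; rewrite !mxE; apply: (row'_eq hA).
  by rewrite inE iE (inj_eq lift_inj) eq_sym neq_lift.
- apply/matrixP => r m; rewrite !mxE; apply: (row'_eq hB).
  by rewrite inE iE (inj_eq lift_inj) eq_sym neq_lift.
Qed.

(** Adjacency is essential: otherwise the remaining rows would come out in a different order. *)
Lemma row'_xrow_adjacent (i j : 'I_p.+1) (M : 'M[R]_(p.+1, n)) :
  j = i.+1 :> nat -> row' i (xrow i j M) = row' j M.
Proof.
move=> jE; apply/matrixP => r m; rewrite !mxE; congr (M _ _).
apply: val_inj; case: tpermP => [/(congr1 val)|/(congr1 val)|/eqP + /eqP].
- by rewrite /= /bump; case: leqP; case: leqP; lia.
- by rewrite /= /bump; case: leqP; case: leqP; lia.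
- by rewrite -!val_eqE /= /bump; case: leqP; case: leqP; lia.
Qed.

Lemma covector_wedge_antisymmetric :
  antisymmetric_rows w -> antisymmetric_rows covector_wedge.
Proof.
move=> sw; apply: antisymmetric_adjacent => i j M jE.
have ij : i != j by rewrite -val_eqE /= jE; lia.
have ij_row : row i (xrow i j M) = row j M.
  by apply/rowP => m; rewrite !mxE tpermL.
have ji_row : row j (xrow i j M) = row i M.
  by apply/rowP => m; rewrite !mxE tpermR.
have ij_row' := row'_xrow_adjacent M jE.
have ji_row' : row' j (xrow i j M) = row' i M.
  rewrite -(row'_xrow_adjacent _ jE); congr (row' i _).
  by rewrite /xrow -row_permM tperm2 row_perm1.
(* The swap exchanges the terms i and j, whose signs are opposite since j = i + 1. In any other term
   it swaps two rows of the argument of [w]. *)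
rewrite /covector_wedge (reindex_inj (@perm_inj _ (tperm i j))) -sumrN.
apply: eq_bigr => k _; case: tpermP => [->|->|/eqP ki /eqP kj].
- by rewrite ji_row ji_row' jE exprS mulN1r mulNr.
- by rewrite ij_row ij_row' jE exprS mulN1r mulNr opprK.
have [i' iE _] := unlift_some ki; have [j' j'E _] := unlift_some kj.
have -> : row k (xrow i j M) = row k M.
  by apply/rowP => m; rewrite !mxE tpermD// eq_sym.
have -> : row' k (xrow i j M) = xrow i' j' (row' k M).
  apply/matrixP => r m; rewrite !mxE (inj_tperm _ _ _ (@lift_inj _ k)).
  by rewrite -iE -j'E.
rewrite sw; first by rewrite !mulrN.
by apply/eqP => i'j'; move: ij; rewrite iE i'j' -j'E eqxx.
Qed.
End CovectorWedge.

(** * Leibniz rule and chain rule on open sets *)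

Section SmoothFunctions.
Context {R : realType} {n : nat} (U : set 'rV[R]_n) (oU : open U).

Lemma valL_mul (f g : U -> R^o) :
  'valL_0 (fun x => f x * g x : R^o) = 'valL_0 f * 'valL_0 g.
Proof.
apply/funext => x; have [Ux|Ux] := pselect (U x).
  by rewrite (valL_Sub _ (fun x => f x * g x : R^o) Ux) fctE !(valL_Sub _ _ Ux).
by rewrite fctE !valL_out// mulr0.
Qed.

Lemma smooth_mul (f g : U -> R^o) :
  smooth f -> smooth g -> smooth (fun x => f x * g x : R^o).
Proof. by move=> sf sg k; rewrite valL_mul; exact: Ck_mul. Qed.

Lemma diff_mulE (f g : 'rV[R]_n -> R^o) x v :
  differentiable f x -> differentiable g x ->
  'd (f * g) x v = f x * 'd g x v + g x * 'd f x v.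
Proof. by move=> df dg; exact: (congr1 (fun h => h v) (diffM df dg)). Qed.

Lemma smooth_sum m (f : 'I_m -> U -> R^o) :
  (forall i, smooth (f i)) -> smooth (fun x => \sum_i f i x : R^o).
Proof.
move=> sf k; apply: (Ck_ext oU _ (Ck_sum oU (fun i => sf i k))) => x Ux.
rewrite (valL_Sub _ (fun x => \sum_i f i x : R^o) Ux) fct_sumE.
by apply: eq_bigr => i _; rewrite (valL_Sub _ _ Ux).
Qed.

Lemma smooth_diff (f : U -> R^o) v :
  smooth f -> smooth (fun x : U => 'd ('valL_0 f) (set_val x) v : R^o).
Proof.
move=> sf k; have [_ /(_ v)] := sf k.+1.
apply: (Ck_ext oU) => x Ux.
by rewrite (valL_Sub _ (fun x : U => 'd ('valL_0 f) (set_val x) v : R^o) Ux).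
Qed.

(** The Leibniz rule holds summand by summand, as [covector_wedge] and [ext_deriv] carry the same
    signs. *)
Lemma ext_deriv_mul p (f : U -> R^o) (w : U -> 'M[R]_(p, n) -> R) x M :
  smooth f -> (forall N, smooth (fun y => w y N : R^o)) ->
  ext_deriv (fun y N => f y * w y N) x M
  = covector_wedge ('d ('valL_0 f) (set_val x)) (w x) M + f x * ext_deriv w x M.
Proof.
move=> sf sw; rewrite /ext_deriv /covector_wedge mulr_sumr -big_split /=.
apply: eq_bigr => i _.
have df := smooth_differentiable x sf.
have dw := smooth_differentiable x (sw (row' i M)).
set N := row' i M.
pose D (h : 'rV[R]_n -> R^o) := (-1) ^+ i * 'd h (set_val x) (row i M).
rewrite -[LHS]/(D ('valL_0 (fun y => f y * w y N : R^o))) valL_mul.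
have -> := congr1 ( *%R ((-1) ^+ i)) (diff_mulE (row i M) df dw) : D _ = _.
rewrite (valL_val 0 f) (valL_val 0 (fun y => w y (row' i M) : R^o)).
by rewrite addrC mulrDr [w _ _ * _]mulrC [_ * (f x * _)]mulrCA.
Qed.

Lemma diff_valL_comp m (V : set 'rV[R]_m) (f : U -> R^o) (F : V -> U) (y : V) v :
  open V -> smooth f -> smooth (set_val \o F) ->
  'd ('valL_0 (f \o F)) (set_val y) v
  = 'd ('valL_0 f) (set_val (F y)) (v *m 'J ('valL_0 (set_val \o F)) (set_val y)).
Proof.
move=> oV sf sF.
have FE : 'valL_0 (set_val \o F) (set_val y) = set_val (F y).
  exact: (valL_val 0 (set_val \o F)).
(* Outside [V] the two sides may differ: the inner extension is 0 there, a point where [f] need not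
   vanish. *)
have compE : \forall z \near set_val y,
    ('valL_0 f \o 'valL_0 (set_val \o F)) z = 'valL_0 (f \o F) z.
  apply: filterS (open_nbhs_nbhs (conj oV (set_valP y))) => z Vz.
  rewrite (valL_Sub _ (f \o F) Vz).
  rewrite -[LHS]/('valL_0 f ('valL_0 (set_val \o F) z)).
  rewrite (valL_Sub _ (set_val \o F) Vz).
  exact: (valL_val 0 f).
have dF := smooth_differentiable y sF.
have df := smooth_differentiable (F y) sf; rewrite -FE in df.
have [_ E] := near_eq_diff compE (differentiable_comp dF df).
rewrite mul_rV_lin1 -FE.
apply: (etrans (congr1 (fun h => h v) E)).
exact: (congr1 (fun h => h v) (diff_comp dF df)).
Qed.
End SmoothFunctions.

Section FunctionTimesForm.
Context {R : realType} {p : nat} {X : diffeologicalType R}.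
Variables (f : smooth_map X R^o) (a : form p X).

Lemma smooth_fun_plot (P : plot X) : smooth (f \o P).
Proof. by have [] := smooth_funP f (plotP P). Qed.

Definition fun_mul : preform p X := fun P x M => f (P x) * form_val a P x M.

Lemma fun_mul_form : fun_mul \in form_pred.
Proof.
have /asboolP[la sa ma na] := form_valP a; apply/asboolP; split.
- move=> P x i c M A B hM hA hB; rewrite /fun_mul (la P x i c M A B)//.
  by rewrite mulrDr mulrCA.
- by move=> P x i j M ij; rewrite /fun_mul sa// mulrN.
- move=> P M; have oP := is_plot_open (plotP P).
  exact: (smooth_mul oP (smooth_fun_plot P) (ma P M)).
- by move=> P m V F oV sF y M; rewrite /fun_mul na.
Qed.

Definition form_mul : form p X := Form fun_mul_form.

Definition diff_wedge : preform p.+1 X := fun P x =>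
  covector_wedge ('d ('valL_0 (f \o P)) (set_val x)) (form_val a P x).

(** Naturality combines that of [a] with the chain rule for [f \o P], since deleting a row commutes
    with multiplication by the Jacobian. *)
Lemma diff_wedge_form : diff_wedge \in form_pred.
Proof.
have /asboolP[la sa ma na] := form_valP a; apply/asboolP; split.
- by move=> P x; apply: covector_wedge_multilinear.
- by move=> P x; apply: covector_wedge_antisymmetric.
- move=> P M; have oP := is_plot_open (plotP P).
  rewrite /diff_wedge /covector_wedge; apply: (smooth_sum oP) => i.
  apply: (smooth_mul oP); first exact: smooth_cst.
  by apply: (smooth_mul oP) => //; exact: (smooth_diff oP _ (smooth_fun_plot P)).
- move=> P m V F oV sF y M; apply: eq_bigr => k _.
  rewrite na row_mul !row'Esub mul_rowsub_mx; congr (_ * (_ * _)).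

  exact: (diff_valL_comp y (row k M) oV (smooth_fun_plot P) sF).
Qed.

Definition form_diff_wedge : form p.+1 X := Form diff_wedge_form.

End FunctionTimesForm.

(* The exterior derivative of [f a] is a form as soon as that of [a] is: this
   is how all the forms of degree [p.+1] below are obtained, without ever
   proving that exterior differentiation is natural in general. *)
Lemma ext_d_mul (R : realType) p (X : diffeologicalType R)
    (f : smooth_map X R^o) (a : form p X) (b : form p.+1 X) :
  form_val b = ext_d a ->
  ext_d (form_mul f a) = form_val (form_diff_wedge f a + form_mul f b).
Proof.
move=> ba; apply: preform_ext => P x M; have /asboolP[_ _ ma _] := form_valP a.
transitivity (diff_wedge f a x M + f (P x) * form_val b P x M); last by [].
rewrite ba.
exact: (ext_deriv_mul x M (smooth_fun_plot f P) (ma P)).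
Qed.


(** As [ext_d] takes values in preforms, it can be iterated only where the derivative of [a] is
    known to underlie a form [b]. *)
Lemma ext_d_ext_d (R : realType) p (X : diffeologicalType R) (a : form p X)
    (b : form p.+1 X) : form_val b = ext_d a -> ext_d b = 0.
Proof.
move=> ba; apply: preform_ext => P x M; have /asboolP[_ _ ma _] := form_valP a.
rewrite -[LHS]/(ext_deriv (form_val b P) x M) ba.
exact: (ext_deriv_ext_deriv x M (is_plot_open (plotP P)) (ma P)).
Qed.

(** * The Mayer-Vietoris sequence *)

Section Subspaces.
Context {R : realType} {X : diffeologicalType R}.

Lemma Dopen_preimage_val (D N : set X) :
  Dopen N -> Dopen [set t : D | N (set_val t)].
Proof. by move=> oN n U P pP; exact: (oN _ _ (set_val \o P) pP). Qed.

Lemma open_embedding_incl_space (C : set X) :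
  Dopen C -> open_embedding (incl_space C).
Proof.
move=> oC; split; [exact: val_inj | by [] |].
rewrite (_ : range _ = C)//; apply/seteqP; split=> [_ [x _ <-]|x Cx].
  exact: set_valP.
by exists (SigSub (mem_set Cx)).
Qed.

Lemma range_incl_sub (C D : set X) (CD : C `<=` D) :
  range (incl_sub CD) = [set t : D | C (set_val t)].
Proof.
apply/seteqP; split=> [_ [x _ <-]|x Cx]; first exact: (set_valP x).
have Cx' : C (set_val x) by [].
by exists (SigSub (mem_set Cx')) => //; exact: val_inj.
Qed.

Lemma open_embedding_incl_sub (C D : set X) (CD : C `<=` D) :
  Dopen C -> open_embedding (incl_sub CD).
Proof.
move=> oC; split; last by rewrite range_incl_sub; exact: Dopen_preimage_val.
  by move=> x y /(congr1 set_val) xy; exact: val_inj.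
by [].
Qed.

End Subspaces.

(** * Extension by zero of forms cut off by a function *)

Section Cutoff.
Context {R : realType} {X : diffeologicalType R}.
Variables (C D N : set X) (CD : C `<=` D).
Hypotheses (oC : Dopen C) (oN : Dopen N) (DCN : D `<=` C `|` N).

Let DN : set D := [set t | N (set_val t)].

Let h1 : open_embedding (incl_sub CD) := open_embedding_incl_sub CD oC.

Let h2 : open_embedding (incl_space DN) :=
  open_embedding_incl_space (Dopen_preimage_val oN).

Let coverD (t : D) : range (incl_sub CD) t \/ range (incl_space DN) t.
Proof.
have [Ct|Nt] := DCN (set_valP t); first by left; rewrite range_incl_sub.
right; have Dt : DN t by [].
by exists (SigSub (mem_set Dt)).
Qed.

(** The form [a] on [C] is glued with the zero form on the part of [D] inside [N], where [a]
    vanishes. *)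
Lemma extend_by_zero p (a : form p C) :
  (forall n (U : set 'rV[R]_n) (G : U -> C) (pG : is_plot U G) x M,
     (forall z, N (set_val (G z))) -> form_val a (Plot pG) x M = 0) ->
  exists c : form p D, form_pull (incl_sub CD) c = a /\
    form_pull (incl_space DN) c = 0.
Proof.
move=> a0; apply: (glue_ex h1 h2 coverD) => n U G1 G2 p1 p2 G12 x M.
rewrite a0// => z.
have -> : set_val (G1 z) = set_val (set_val (G2 z)).
  by rewrite -[RHS](congr1 set_val (G12 z)).
exact: (set_valP (G2 z)).
Qed.

(** Both [f a] and its derivative, a form by [ext_d_mul], extend by zero. That the second extension
    is the derivative of the first is checked on [C] and on [N] separately. *)
Lemma extend_form_mul p (f : smooth_map C R^o) (a : form p C) (b : form p.+1 C) :
  (forall x : C, N (set_val x) -> f x = 0) -> form_val b = ext_d a ->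
  exists (c : form p D) (d : form p.+1 D),
    form_pull (incl_sub CD) c = form_mul f a /\ form_val d = ext_d c.
Proof.
move=> f0 ba.
have [|c [c1 c2]] := @extend_by_zero _ (form_mul f a).
  move=> n U G pG x M NG.
  by rewrite -[LHS]/(f (G x) * form_val a (Plot pG) x M) f0 ?mul0r.
have [|d [d1 d2]] := @extend_by_zero _ (form_diff_wedge f a + form_mul f b).
  move=> n U G pG x M NG.
  rewrite -[LHS]/(diff_wedge f a x M + f (G x) * form_val b (Plot pG) x M).
  rewrite f0// mul0r addr0 /diff_wedge /covector_wedge big1// => k _.
  (* On a plot with values in [N] the function [f] vanishes throughout, hence so does its
     differential. *)
  have -> : 'valL_0 (f \o Plot pG) = cst 0.
    apply/funext => z; have [Uz|Uz] := pselect (U z).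
      by rewrite (valL_Sub _ _ Uz)/= f0.
    by rewrite valL_out.
  by rewrite diff_cst mul0r mulr0.
exists c, d; split=> //.
apply: (preform_separated h1 h2 coverD (@form_local _ _ _ d)
  (@ext_d_local _ _ _ c)).
  rewrite -[LHS]/(form_val (form_pull (incl_sub CD) d)) d1.
  by rewrite -ext_d_pull c1 (ext_d_mul f ba).
rewrite -[LHS]/(form_val (form_pull (incl_space DN) d)) d2.
by rewrite -ext_d_pull c2 linear0.
Qed.
End Cutoff.

Lemma ext_dB (R : realType) (X : diffeologicalType R) p (a b : form p X) :
  ext_d (a - b) = ext_d a - ext_d b.
Proof. exact: linearB. Qed.

Lemma form_pullB (R : realType) (X Y : diffeologicalType R) (f : smooth_map X Y) p
    (a b : form p Y) : form_pull f (a - b) = form_pull f a - form_pull f b.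
Proof. exact: linearB. Qed.

Lemma exact_closed (R : realType) (X : diffeologicalType R) p (a : form p X) :
  is_exact a -> ext_d a = 0.
Proof.
by case: p a => [|p] a /=; [move=> ->; exact: linear0 | move=> [b /ext_d_ext_d]].
Qed.

Lemma class_eq0 (R : realType) (X : diffeologicalType R) p (a : cocycle p X) :
  cohomology_class a = 0 <-> is_exact (cocycle_val a).
Proof.
rewrite -(linear0 (@cohomology_class R p X)).
by split=> [/cohomology_classE|?]; [|apply/cohomology_classE]; rewrite subr0.
Qed.

Section MayerVietoris.
Context {R : realType} {X : diffeologicalType R} (A B : set X).
Hypotheses (oA : Dopen A) (oB : Dopen B) (coverAB : A `|` B = [set: X]).
Local Notation i1 := (incl_sub (@subIsetl _ A B)).
Local Notation i2 := (incl_sub (@subIsetr _ A B)).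
Local Notation j1 := (incl_space A).
Local Notation j2 := (incl_space B).

Let h1 : open_embedding j1 := open_embedding_incl_space oA.
Let h2 : open_embedding j2 := open_embedding_incl_space oB.

Let cover (x : X) : range j1 x \/ range j2 x.
Proof.
have : (A `|` B) x by rewrite coverAB.
by case=> Cx; [left|right]; exists (SigSub (mem_set Cx)).
Qed.

Lemma mv_form_pullC p (c : form p X) :
  form_pull i1 (form_pull j1 c) = form_pull i2 (form_pull j2 c).
Proof.
apply: val_inj; apply: preform_ext => P x M.
exact: (@form_local _ _ _ c (plot_push j2 (plot_push i2 P)) _ _
  (plotP (plot_push j1 (plot_push i1 P))) id).
Qed.

Lemma mv_form_glue p (a : form p A) (b : form p B) :
  form_pull i1 a = form_pull i2 b ->
  exists c : form p X, form_pull j1 c = a /\ form_pull j2 c = b.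
Proof.
move=> ab; apply: (glue_ex h1 h2 cover) => n U G1 G2 p1 p2 G12 x M.
have GAB z : (A `&` B) (set_val (G1 z)).
  split; first exact: (set_valP (G1 z)).
  have -> : set_val (G1 z) = set_val (G2 z) by exact: G12.
  exact: (set_valP (G2 z)).
(* Two plots of [A] and [B] with the same values in [X] come from one plot of the intersection,
   where the hypothesis can be used. *)
pose G z : A `&` B := SigSub (mem_set (GAB z)).
have pG : is_plot U G by exact: p1.
have -> : form_val a (Plot p1) x M = form_val (form_pull i1 a) (Plot pG) x M.
  apply: (form_local a (P := plot_push i1 (Plot pG)) p1 (F := id)) => // z.
  exact: val_inj.
rewrite ab; apply/esym.
apply: (form_local b (P := plot_push i2 (Plot pG)) p2 (F := id)) => // z.
by apply: val_inj; exact: esym (G12 z).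
Qed.

Lemma mv_preform_eq p (a b : preform p X) :
  local_preform a -> local_preform b ->
  preform_pull j1 a = preform_pull j1 b ->
  preform_pull j2 a = preform_pull j2 b ->
  a = b.
Proof. exact: (preform_separated h1 h2 cover). Qed.

(** * The connecting homomorphism and exactness *)

Section Connecting.
(** Surjectivity of the difference map, with the derivatives of the preimages supplied as forms.
    This is all that is taken from the partition of unity, and [mv_split] provides it. *)
Hypothesis split : forall p (w : form p (A `&` B)) (z : form p.+1 (A `&` B)),
  form_val z = ext_d w ->
  exists (a : form p A) (b : form p B) (da : form p.+1 A) (db : form p.+1 B),
    [/\ form_pull i1 a - form_pull i2 b = w,
        form_val da = ext_d a & form_val db = ext_d b].

(** If w = dv, splitting v and differentiating splits w into exact forms; in degree 0 an exact form
    is 0. *)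
Lemma mv_exact_split p (w : form p (A `&` B)) : is_exact w ->
  exists (a : form p A) (b : form p B),
    [/\ is_exact a, is_exact b & form_pull i1 a - form_pull i2 b = w].
Proof.
case: p w => [|p] w /= => [->|[v wE]].
  by exists 0, 0; split=> //; rewrite !linear0 addr0.
have [a [b [da [db [ab daE dbE]]]]] := split wE.
exists da, db; split; [by exists a | by exists b |].
apply: val_inj; rewrite -[RHS]/(form_val w) wE -ab ext_dB !ext_d_pull -daE -dbE.
by [].
Qed.

(** As a relation, with [a] and [b] quantified, it is visibly linear; no linear choice of the
    splitting is needed. *)
Definition connects p (w : cocycle p (A `&` B)) (g : cocycle p.+1 X) : Prop :=
  exists (a : form p A) (b : form p B),
    [/\ form_pull i1 a - form_pull i2 b = cocycle_val w,
        form_val (form_pull j1 (cocycle_val g)) = ext_d a &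
        form_val (form_pull j2 (cocycle_val g)) = ext_d b].

Lemma connects_ex p (w : cocycle p (A `&` B)) : exists g, connects w g.
Proof.
have wE : form_val (0 : form p.+1 (A `&` B)) = ext_d (cocycle_val w).
  by rewrite (eqP (cocycle_valP w)).
have [a [b [da [db [ab daE dbE]]]]] := split wE.
(* The derivatives of [a] and [b] agree on the intersection because [w] is closed. *)
have [|g [g1 g2]] := mv_form_glue (a := da) (b := db).
  apply: val_inj; apply/eqP; rewrite -subr_eq0; apply/eqP.
  transitivity (ext_d (form_pull i1 a - form_pull i2 b)).
    by rewrite ext_dB !ext_d_pull -daE -dbE.
  by rewrite ab -wE.
have dg : g \in @cocycle_pred R p.+1 X.
  apply/eqP; apply: mv_preform_eq.
  - exact: ext_d_local.
  - by [].
  - by rewrite -ext_d_pull g1 (ext_d_ext_d daE).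
  - by rewrite -ext_d_pull g2 (ext_d_ext_d dbE).
by exists (Cocycle dg), a, b; split=> //; [rewrite -daE -g1 | rewrite -dbE -g2].
Qed.

Lemma connects_linear p c (w w' : cocycle p (A `&` B)) (g g' : cocycle p.+1 X) :
  connects w g -> connects w' g' -> connects (c *: w + w') (c *: g + g').
Proof.
move=> [a [b [ab ga gb]]] [a' [b' [ab' ga' gb']]].
exists (c *: a + a'), (c *: b + b'); split.
- rewrite !form_pull_linear.
  rewrite -[RHS]/(c *: cocycle_val w + cocycle_val w') -ab -ab' scalerBr.
  by rewrite opprD addrACA.
- by rewrite ext_d_linear -ga -ga'.
- by rewrite ext_d_linear -gb -gb'.
Qed.

(** This makes the connecting map well defined on classes. Subtracting exact [a'] and [b'] that also
    split [w] leaves forms that glue to a primitive of [g]. *)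
Lemma connects_exact p (w : cocycle p (A `&` B)) (g : cocycle p.+1 X) :
  connects w g -> is_exact (cocycle_val w) -> is_exact (cocycle_val g).
Proof.
move=> [a [b [ab ga gb]]] /mv_exact_split[a' [b' [ea' eb' ab']]].
have [|c [c1 c2]] := mv_form_glue (a := a - a') (b := b - b').
  apply/eqP; rewrite -subr_eq0 !form_pullB; apply/eqP.
  transitivity ((form_pull i1 a - form_pull i2 b)
                - (form_pull i1 a' - form_pull i2 b')).
    by rewrite !opprD addrACA.
  by rewrite ab ab' subrr.
exists c; apply: mv_preform_eq.
- exact: form_local.
- exact: ext_d_local.
- rewrite -[LHS]/(form_val (form_pull j1 (cocycle_val g))) ga -ext_d_pull c1.
  by rewrite ext_dB (exact_closed ea') subr0.
- rewrite -[LHS]/(form_val (form_pull j2 (cocycle_val g))) gb -ext_d_pull c2.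
  by rewrite ext_dB (exact_closed eb') subr0.
Qed.

Definition connecting p (h : deRham p (A `&` B)) : deRham p.+1 X :=
  cohomology_class (projT1 (cid (connects_ex (repr (h : Quotient.quot _))))).

Lemma connecting_class p (w : cocycle p (A `&` B)) (g : cocycle p.+1 X) :
  connects w g -> connecting (cohomology_class w) = cohomology_class g.
Proof.
move=> wg; rewrite /connecting; case: cid => g' /= wg'.
(* By linearity [g' - g] is connected to the difference of two representatives of one class, which
   is exact. *)
apply/cohomology_classE; rewrite addrC -scaleN1r.
apply: connects_exact (connects_linear (-1) wg wg') _.
rewrite scaleN1r addrC; apply/cohomology_classE.
exact: cohomology_class_repr.
Qed.

Lemma connecting_linear p : linear (@connecting p).
Proof.
move=> c h h'; rewrite -(cohomology_class_repr h) -(cohomology_class_repr h').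
set w := repr _; set w' := repr _.
have [g wg] := connects_ex w; have [g' wg'] := connects_ex w'.
rewrite -linearP (connecting_class (connects_linear c wg wg')) linearP.
by rewrite (connecting_class wg) (connecting_class wg').
Qed.

HB.instance Definition _ p := GRing.isLinear.Build R (deRham p (A `&` B))
  (deRham p.+1 X) *:%R (@connecting p) (@connecting_linear p).

(** The only exact 0-form is 0, so this is the fact that forms are determined by their restrictions
    to [A] and [B]. *)
Lemma mv_restrict0_injective :
  [set w : deRham 0 X | mv_restrict A B w = 0] = [set 0].
Proof.
apply/seteqP; split=> [w|_ ->]; last first.
  by rewrite /= /mv_restrict !linear0.
rewrite /= -(cohomology_class_repr w); set a := repr _.
rewrite /mv_restrict !deRham_pull_class => -[/class_eq0/= a1 /class_eq0/= a2].
apply/class_eq0 => /=; apply: val_inj; apply: mv_preform_eq.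
- exact: form_local.
- by [].
- by rewrite -[LHS]/(form_val (form_pull j1 (cocycle_val a))) a1.
- by rewrite -[LHS]/(form_val (form_pull j2 (cocycle_val a))) a2.
Qed.

Lemma exact_restrict_difference p :
  exact_at (@mv_restrict R X A B p) (@mv_difference R X A B p).
Proof.
apply/seteqP; split=> [_ [w _ <-]|[u v]] /=.
  rewrite -(cohomology_class_repr w); set c := repr _.
  rewrite /mv_restrict /mv_difference /= !deRham_pull_class -linearB.
  apply/eqP; rewrite linearB subr_eq0; apply/eqP; congr cohomology_class.
  by apply: val_inj; exact: mv_form_pullC.
rewrite -(cohomology_class_repr u) -(cohomology_class_repr v).
set a := repr _; set b := repr _.
rewrite /mv_difference /= !deRham_pull_class -linearB => /class_eq0/=.
move=> /mv_exact_split[a' [b' [ea eb ab]]].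
(* The corrected forms stay in the classes of [a] and [b] and now agree on the intersection. *)
have [|c [c1 c2]] := mv_form_glue (a := cocycle_val a - a')
  (b := cocycle_val b - b').
  apply/eqP; rewrite -subr_eq0 !form_pullB; apply/eqP.
  transitivity ((form_pull i1 (cocycle_val a) - form_pull i2 (cocycle_val b))
                - (form_pull i1 a' - form_pull i2 b')).
    by rewrite !opprD addrACA.
  by rewrite ab; exact: subrr.
have dc : c \in @cocycle_pred R p X.
  apply/eqP; apply: mv_preform_eq.
  - exact: ext_d_local.
  - by [].
  - rewrite -ext_d_pull c1 ext_dB (exact_closed ea) subr0.
    by rewrite (eqP (cocycle_valP a)).
  - rewrite -ext_d_pull c2 ext_dB (exact_closed eb) subr0.
    by rewrite (eqP (cocycle_valP b)).
exists (cohomology_class (Cocycle dc)) => //.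
rewrite /mv_restrict !deRham_pull_class; congr pair.
  apply/esym/cohomology_classE.
  rewrite -[cocycle_val _]/(cocycle_val a - form_pull j1 c) c1.
  by rewrite opprB addrC subrK.
apply/esym/cohomology_classE.
rewrite -[cocycle_val _]/(cocycle_val b - form_pull j2 c) c2.
by rewrite opprB addrC subrK.
Qed.

Lemma exact_difference_connecting p :
  exact_at (@mv_difference R X A B p) (@connecting p).
Proof.
apply/seteqP; split=> [_ [[u v] _ <-]|h] /=.
  rewrite -(cohomology_class_repr u) -(cohomology_class_repr v).
  set a := repr _; set b := repr _.
  rewrite /mv_difference /= !deRham_pull_class -linearB.
  (* The difference is already split by the closed forms [a] and [b], so it connects to 0. *)
  rewrite (connecting_class (g := 0)) ?linear0//.
  exists (cocycle_val a), (cocycle_val b).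
  by rewrite (eqP (cocycle_valP a)) (eqP (cocycle_valP b)).
rewrite -(cohomology_class_repr h); set w := repr _.
have [g wg] := connects_ex w; rewrite (connecting_class wg) => /class_eq0[c gc].
have [a [b [ab ga gb]]] := wg.
(* Since g = dc, subtracting the restrictions of [c] makes [a] and [b] closed without changing their
   difference. *)
have ca : a - form_pull j1 c \in @cocycle_pred R p A.
  by apply/eqP; rewrite ext_dB -ga ext_d_pull -gc subrr.
have cb : b - form_pull j2 c \in @cocycle_pred R p B.
  by apply/eqP; rewrite ext_dB -gb ext_d_pull -gc subrr.
exists (cohomology_class (Cocycle ca), cohomology_class (Cocycle cb)) => //.
rewrite /mv_difference /= !deRham_pull_class -linearB; congr cohomology_class.
apply: val_inj; rewrite -[RHS]/(cocycle_val w) -ab.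
transitivity (form_pull i1 (a - form_pull j1 c)
              - form_pull i2 (b - form_pull j2 c)).
  by [].
by rewrite !form_pullB mv_form_pullC opprB addrA subrK.
Qed.

Lemma exact_connecting_restrict p :
  exact_at (@connecting p) (@mv_restrict R X A B p.+1).
Proof.
apply/seteqP; split=> [_ [h _ <-]|u] /=.
  rewrite -(cohomology_class_repr h); set w := repr _.
  have [g wg] := connects_ex w; rewrite (connecting_class wg).
  have [a [b [_ ga gb]]] := wg.
  rewrite /mv_restrict !deRham_pull_class; congr pair; apply/class_eq0.
    by exists a.
  by exists b.
rewrite -(cohomology_class_repr u); set g := repr _.
rewrite /mv_restrict !deRham_pull_class => -[/class_eq0[a ga] /class_eq0[b gb]].
(* The primitives [a] and [b] of the two restrictions of [g] have a closed difference, and it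
   connects to [g] by construction. *)
have cw : form_pull i1 a - form_pull i2 b \in @cocycle_pred R p (A `&` B).
  apply/eqP; rewrite ext_dB !ext_d_pull -ga -gb.
  rewrite -[LHS]/(form_val (form_pull i1 (form_pull j1 (cocycle_val g))
    - form_pull i2 (form_pull j2 (cocycle_val g)))).
  by rewrite mv_form_pullC subrr.
exists (cohomology_class (Cocycle cw)) => //.
by apply: connecting_class; exists a, b.
Qed.
End Connecting.

Lemma mv_split (phi : bool -> X -> R^o) :
  partition_of_unity (fun b : bool => if b then A else B) phi ->
  forall p (w : form p (A `&` B)) (z : form p.+1 (A `&` B)),
  form_val z = ext_d w ->
  exists (a : form p A) (b : form p B) (da : form p.+1 A) (db : form p.+1 B),
    [/\ form_pull i1 a - form_pull i2 b = w,
        form_val da = ext_d a & form_val db = ext_d b].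
Proof.
move=> [sphi _ suppphi _ sumphi] p w z zE.
(* A D-open set on which [phi c] vanishes; the index [true] stands for [A] and [false] for [B]. *)
pose N c : set X := ~` supp (phi c).
have oN c : Dopen (N c) by exact: (closed_openC (@closed_closure (Dspace X) _)).
have N0 c x : N c x -> phi c x = 0.
  by move=> Nx; apply/eqP/negP => /negP px; apply: Nx; exact: subset_closure.
have phi1 x : phi true x + phi false x = 1.
  rewrite -(sumphi x) (fsbigE [:: true; false])//; last by case.
  by rewrite !big_cons big_nil !in_setT /= addr0.
have oAB : Dopen (A `&` B) := DopenI oA oB.
have sf c : is_smooth (phi c \o set_val : A `&` B -> R^o).
  by move=> n U P pP; exact: (sphi c n U (set_val \o P)).
pose f c := SmoothMap (sf c).
(* The support of [phi false] lies in [B], so points of [A] outside [B] avoid it. Hence [phi false]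
   is the factor used for extending to [A]. *)
have AN : A `<=` A `&` B `|` N false.
  move=> x Ax; have [Bx|Bx] := pselect (B x); [by left | right].
  by move=> /(suppphi false).
have BN : B `<=` A `&` B `|` N true.
  move=> x Bx; have [Ax|Ax] := pselect (A x); [by left | right].
  by move=> /(suppphi true).
have [a [da [aE daE]]] := extend_form_mul (@subIsetl _ A B) oAB (oN false) AN
  (f := f false) (fun x => N0 false (set_val x)) zE.
have [b [db [bE dbE]]] := extend_form_mul (@subIsetr _ A B) oAB (oN true) BN
  (f := f true) (fun x => N0 true (set_val x)) zE.
(* The sign turns the difference of restrictions into the sum of the two products, which is [w]. *)
exists a, (- b), da, (- db); split=> //; last first.
  by rewrite -[- b]sub0r ext_dB linear0 sub0r -dbE.
rewrite -[- b]sub0r form_pullB linear0 sub0r opprK aE bE.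
apply: val_inj; apply: preform_ext => P x M.
rewrite -[LHS]/(phi false (set_val (P x)) * form_val w P x M
  + phi true (set_val (P x)) * form_val w P x M).
by rewrite -mulrDl addrC phi1 mul1r.
Qed.
End MayerVietoris.

Theorem theorem4p3 (R : realType) (X : diffeologicalType R) (A B : set X)
    (openA : Dopen A) (openB : Dopen B) (coverAB : A `|` B = [set: X])
    (pou : exists phi : bool -> X -> R^o,
       partition_of_unity (fun b : bool => if b then A else B) phi) :
  exists delta : forall p : nat,
      {linear deRham p (A `&` B) -> deRham p.+1 X},
    [set w : deRham 0 X | mv_restrict A B w = 0] = [set 0] /\
    (forall p : nat,
       [/\ exact_at (@mv_restrict R X A B p) (@mv_difference R X A B p),
           exact_at (@mv_difference R X A B p) (delta p) &
           exact_at (delta p) (@mv_restrict R X A B p.+1)]).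
Proof.
have [phi pouphi] := pou.
have split := mv_split openA openB pouphi.
exists (fun p => connecting openA openB coverAB split (p := p)).
split; first exact: mv_restrict0_injective.
move=> p; split.
- exact: exact_restrict_difference.
- exact: exact_difference_connecting.
- exact: exact_connecting_restrict.
Qed.
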